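(* Let $n\ge3$, $\varphi\in(0,\pi/2)$, $k\in\{2,\dots,n-1\}$ even, $r>0$, and let $M(r)$ be the tube of radius $r$ around $W^{2n-k}_\varphi$ in $\mathbb{C}H^n$. Put $$\beta_{r,\varphi}=27\sin^2(\varphi)\tanh^2\tfrac r2\,\operatorname{sech}^4\tfrac r2-2 ,$$ and let $u^1_{r,\varphi},u^2_{r,\varphi},u^3_{r,\varphi}$ be the three complex cubic roots of the unit complex number $\bigl(\beta_{r,\varphi}+\sqrt{\beta_{r,\varphi}^2-4}\bigr)/2$. Then the principal curvatures of $M(r)$ with respect to the unit normal pointing towards $W^{2n-k}_\varphi$ are $$\lambda_i(r)=-\frac16\Bigl(\coth\tfrac r2\,\Bigl(u^i_{r,\varphi}+\frac1{u^i_{r,\varphi}}\Bigr)+\operatorname{csch}\tfrac r2\,\operatorname{sech}\tfrac r2+4\tanh\tfrac r2\Bigr),\qquad i\in\{1,2,3\},$$ each with multiplicity $1$, together with $\tfrac12\tanh\tfrac r2$ with multiplicity $2n-k-2$ and $\tfrac12\coth\tfrac r2$ with multiplicity $k-2$. The numbers $\lambda_1(r),\lambda_2(r),\lambda_3(r)$ are real and pairwise distinct, and neither $\tfrac12\tanh\tfrac r2$ nor $\tfrac12\coth\tfrac r2$ is among them. Consequently $M(r)$ has five distinct constant principal curvatures when $k>2$ and four distinct principal curvatures when $k=2$.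
   Context: $\mathbb{C}H^n$ is complex hyperbolic space with its metric of constant holomorphic sectional curvature $-1$ and complex structure $J$. A real linear subspace $V$ of a complex vector space with compatible inner product has constant Kähler angle $\varphi$ if for every nonzero $v\in V$ the orthogonal projection of $Jv$ onto $V$ has length $\cos(\varphi)\|v\|$. Definition of $W^{2n-k}_\varphi$: fix $o\in\mathbb{C}H^n$ and a point $x$ in the ideal boundary, and let $SU(1,n)=KAN$ be the corresponding Iwasawa decomposition. $AN$ acts simply transitively on $\mathbb{C}H^n$, so $\mathbb{C}H^n$ is identified with $AN$ with a left-invariant metric and left-invariant $J$, and its Lie algebra $\mathfrak{a}+\mathfrak{n}=\mathfrak{a}+\mathfrak{g}_\alpha+\mathfrak{g}_{2\alpha}$ (orthogonal sum) with $T_o\mathbb{C}H^n$. Here $\mathfrak{a}=\mathbb{R}B$ with $B$ the unit vector at $o$ pointing to $x$, $\mathfrak{g}_{2\alpha}=\mathbb{R}Z$ with $Z=JB$, $\mathfrak{g}_\alpha\cong\mathbb{C}^{n-1}$ is $J$-invariant, and the nontrivial brackets are $[B,Z]=Z$, $2[B,U]=U$, $[U,V]=\langle JU,V\rangle Z$ for $U,V\in\mathfrak{g}_\alpha$. Let $\mathfrak{w}\subset\mathfrak{g}_\alpha$ be a real linear subspace whose orthogonal complement $\mathfrak{w}^\perp=\mathfrak{g}_\alpha\ominus\mathfrak{w}$ has real dimension $k$ and constant Kähler angle $\varphi$; let $S\subset AN$ be the connected closed subgroup with Lie algebra $\mathfrak{s}=\mathfrak{a}+\mathfrak{w}+\mathfrak{g}_{2\alpha}$.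 Then $W^{2n-k}_\varphi:=S\cdot o$. The tube of radius $r$ around a submanifold $W$ is $M(r)=\{\exp(r\xi):\xi\in\nu W,\ \|\xi\|=1\}$, with $\exp$ the Riemannian exponential map. At $p=\gamma_\xi(r)$, where $\gamma_\xi(t)=\exp(t\xi)$, the unit normal pointing towards $W$ is $-\dot\gamma_\xi(r)$. The shape operator with respect to a unit normal field $\eta$ is $\mathcal{S}_\eta X=-(\bar\nabla_X\eta)^{\top}$, where $\bar\nabla$ is the Levi-Civita connection of $\mathbb{C}H^n$ and $\top$ denotes the tangential component; principal curvatures are its eigenvalues. Multiplicity $0$ (for $k=2$) means the value does not occur. Here $\beta_{r,\varphi}^2<4$, so $\sqrt{\beta_{r,\varphi}^2-4}$ is purely imaginary (either choice of square root gives the same set of values).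
   Formalization: The formula is proved with corrected signs: λ_i = -(1/6)(coth(r/2)(u^i+1/u^i) - csch(r/2)sech(r/2) - 4tanh(r/2)); with the printed plus signs the λ_i would sum to a negative number, whereas for the normal pointing towards W their sum is ½coth(r/2)+(3/2)tanh(r/2) > 0. *)

(* Defs.v *)
From HB Require Import structures.
From mathcomp Require Import all_boot all_order all_algebra.
From mathcomp Require Import all_classical all_reals all_analysis.
From mathcomp Require Import complex.

Set Implicit Arguments.
Unset Strict Implicit.
Unset Printing Implicit Defensive.

Import Order.TTheory GRing.Theory Num.Theory.
Import numFieldNormedType.Exports.
Local Open Scope classical_set_scope.
Local Open Scope ring_scope.

Definition cosh (R : realType) (x : R) : R := (expR x + expR (- x)) / 2.
Definition sinh (R : realType) (x : R) : R := (expR x - expR (- x)) / 2.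
Definition tanh (R : realType) (x : R) : R := sinh x / cosh x.
Definition coth (R : realType) (x : R) : R := cosh x / sinh x.
Definition sech (R : realType) (x : R) : R := (cosh x)^-1.
Definition csch (R : realType) (x : R) : R := (sinh x)^-1.

Definition dot (R : realType) (N : nat) (u v : 'rV[R]_N) : R := (u *m v^T) 0 0.

Definition enorm (R : realType) (N : nat) (u : 'rV[R]_N) : R :=
  Num.sqrt (dot u u).

Definition has_dim (R : realType) (N : nat) (A : set 'rV[R]_N) (d : nat) : Prop :=
  exists V : {vspace 'rV[R]_N}, (forall x, A x <-> x \in V) /\ \dim V = d.

(** * Riemannian geometry in a global chart

  A Riemannian metric on the manifold R^N is a function [g] with [g p] an
  inner product on R^N = T_p R^N. *)

Definition metric (R : realType) (N : nat) :=
  'rV[R]_N -> 'rV[R]_N -> 'rV[R]_N -> R.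

Definition gram (R : realType) (N : nat) (g : metric R N) (p : 'rV[R]_N) :
    'M[R]_N :=
  \matrix_(i, j) g p (delta_mx 0 i) (delta_mx 0 j).

(* Gamma^j_(u,v) = 1/2 g^{lj} (d_u g_{vl} + d_v g_{ul} - d_l g_{uv}), so that
   the Levi-Civita connection is nabla_X Y = D_X Y + christoffel X Y. *)
Definition christoffel (R : realType) (N : nat) (g : metric R N)
    (p u v : 'rV[R]_N) : 'rV[R]_N :=
  (\row_l (2^-1 *
     ('D_u (fun q => g q v (delta_mx 0 l)) p
      + 'D_v (fun q => g q u (delta_mx 0 l)) p
      - 'D_(delta_mx 0 l) (fun q => g q u v) p))) *m invmx (gram g p).

Definition nabla (R : realType) (N : nat) (g : metric R N)
    (X : 'rV[R]_N) (Y : 'rV[R]_N -> 'rV[R]_N) (p : 'rV[R]_N) : 'rV[R]_N :=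
  'D_X Y p + christoffel g p X (Y p).

Definition geodesic (R : realType) (N : nat) (g : metric R N)
    (c : R -> 'rV[R]_N) : Prop :=
  forall t, [/\ derivable c t 1, derivable (derive1 c) t 1 &
    derive1 (derive1 c) t + christoffel g (c t) (derive1 c t) (derive1 c t) = 0].

Definition tangent (R : realType) (N : nat) (M : set 'rV[R]_N) (p : 'rV[R]_N) :
    set 'rV[R]_N :=
  [set v | exists c : R -> 'rV[R]_N,
     [/\ c 0 = p, \forall t \near 0, M (c t), derivable c 0 1
       & derive1 c 0 = v]].

Definition normal (R : realType) (N : nat) (g : metric R N)
    (M : set 'rV[R]_N) (p : 'rV[R]_N) : set 'rV[R]_N :=
  [set v | forall x, tangent M p x -> g p x v = 0].

(* The geodesics t |-> exp (t xi) with xi a unit normal vector of W. *)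
Definition unit_normal_geodesic (R : realType) (N : nat) (g : metric R N)
    (W : set 'rV[R]_N) (c : R -> 'rV[R]_N) : Prop :=
  [/\ geodesic g c, W (c 0), normal g W (c 0) (derive1 c 0)
    & g (c 0) (derive1 c 0) (derive1 c 0) = 1].

Definition tube (R : realType) (N : nat) (g : metric R N)
    (W : set 'rV[R]_N) (r : R) : set 'rV[R]_N :=
  [set p | exists2 c, unit_normal_geodesic g W c & c r = p].

(* [eta] is only constrained on [M]; its values elsewhere merely provide a
   differentiable extension and do not affect [nabla g X eta] for X tangent
   to M. *)
Definition unit_normal_field (R : realType) (N : nat) (g : metric R N)
    (M : set 'rV[R]_N) (eta : 'rV[R]_N -> 'rV[R]_N) : Prop :=
  forall p, M p ->
    [/\ differentiable eta p, normal g M p (eta p) & g p (eta p) (eta p) = 1].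

Definition points_towards (R : realType) (N : nat) (g : metric R N)
    (W : set 'rV[R]_N) (r : R) (eta : 'rV[R]_N -> 'rV[R]_N) : Prop :=
  forall c, unit_normal_geodesic g W c -> eta (c r) = - derive1 c r.

Definition shape_operator (R : realType) (N : nat) (g : metric R N)
    (eta : 'rV[R]_N -> 'rV[R]_N) (p X : 'rV[R]_N) : 'rV[R]_N :=
  let Y := nabla g X eta p in - (Y - g p Y (eta p) *: eta p).

Definition curvature_space (R : realType) (N : nat) (g : metric R N)
    (M : set 'rV[R]_N) (eta : 'rV[R]_N -> 'rV[R]_N) (p : 'rV[R]_N) (l : R) :
    set 'rV[R]_N :=
  [set X | tangent M p X /\ shape_operator g eta p X = l *: X].

Definition principal_curvature (R : realType) (N : nat) (g : metric R N)
    (M : set 'rV[R]_N) (eta : 'rV[R]_N -> 'rV[R]_N) (p : 'rV[R]_N) (l : R) :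
    Prop :=
  exists2 X, X != 0 & curvature_space g M eta p l X.

(** * Real subspaces of C^m

  A vector x + iy of C^m is the real row vector (x, y), so that [dot] is the
  real part of the standard Hermitian product. *)

Definition Jmx (R : realType) (m : nat) (U : 'rV[R]_(m + m)) : 'rV[R]_(m + m) :=
  row_mx (- rsubmx U) (lsubmx U).

Definition orth_compl (R : realType) (N : nat) (V : {vspace 'rV[R]_N}) :
    set 'rV[R]_N :=
  [set x | forall y, y \in V -> dot x y = 0].

Definition is_orth_proj (R : realType) (N : nat) (V : set 'rV[R]_N)
    (x y : 'rV[R]_N) : Prop :=
  V y /\ forall z, V z -> dot (x - y) z = 0.

Definition constant_kahler_angle (R : realType) (m : nat) (phi : R)
    (V : set 'rV[R]_(m + m)) : Prop :=
  forall v, V v -> v != 0 ->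
    exists2 y, is_orth_proj V (Jmx v) y & enorm y = cos phi * enorm v.

(** * Complex hyperbolic space as the solvable group AN

  The triple (a, U, z) stands for Exp (U + z Z) Exp (a B) in AN, which gives a
  global chart.  Since [B, U] = U / 2 and [B, Z] = Z, conjugation by Exp (a B)
  is e^(a/2) on g_alpha and e^a on g_2alpha; and since [U, V] = <JU, V> Z is
  central in n, Exp (U) Exp (V) = Exp (U + V + <JU, V> / 2 Z). *)

Definition AN (R : realType) (n : nat) := 'rV[R]_(1 + (n.-1 + n.-1) + 1).

Section AN.
Variables (R : realType) (n : nat).
Implicit Types p q : AN R n.

Definition mkAN (a : R) (U : 'rV[R]_(n.-1 + n.-1)) (z : R) : AN R n :=
  row_mx (row_mx a%:M U) z%:M.
Definition a_part p : R := lsubmx (lsubmx p) 0 0.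
Definition alpha_part p : 'rV[R]_(n.-1 + n.-1) := rsubmx (lsubmx p).
Definition z_part p : R := rsubmx p 0 0.

Definition mulAN p q : AN R n :=
  let e := expR (a_part p / 2) in
  mkAN (a_part p + a_part q)
       (alpha_part p + e *: alpha_part q)
       (z_part p + expR (a_part p) * z_part q
        + 2^-1 * e * dot (Jmx (alpha_part p)) (alpha_part q)).

Definition oneAN : AN R n := mkAN 0 0 0.

Definition invAN p : AN R n :=
  mkAN (- a_part p)
       (- expR (- (a_part p / 2)) *: alpha_part p)
       (- (expR (- a_part p) * z_part p)).

(* The left-invariant metric which is [dot] at [oneAN], i.e. makes
   a + g_alpha + g_2alpha an orthogonal sum with B and Z of length 1; this is
   the metric of constant holomorphic sectional curvature -1. *)
Definition gAN : metric R (1 + (n.-1 + n.-1) + 1) := fun p u v =>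
  dot ('D_u (mulAN (invAN p)) p) ('D_v (mulAN (invAN p)) p).

Definition is_subgroup (H : set (AN R n)) : Prop :=
  [/\ H oneAN, forall p q, H p -> H q -> H (mulAN p q)
    & forall p, H p -> H (invAN p)].

Definition one_param_subgroup (c : R -> AN R n) : Prop :=
  derivable c 0 1 /\ forall s t, c (s + t) = mulAN (c s) (c t).

(* The connected subgroup with Lie algebra [h], i.e. the subgroup generated
   by the exponentials of the elements of [h]. *)
Definition lie_subgroup (h : set (AN R n)) : set (AN R n) :=
  [set p | forall H, is_subgroup H ->
     (forall c, one_param_subgroup c -> h (derive1 c 0) -> forall t, H (c t)) ->
     H p].

(* The Lie algebra s = a + w + g_2alpha in a + n = T_o AN. *)
Definition s_alg (w : {vspace 'rV[R]_(n.-1 + n.-1)}) : set (AN R n) :=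
  [set v | alpha_part v \in w].

Definition Wphi (w : {vspace 'rV[R]_(n.-1 + n.-1)}) : set (AN R n) :=
  [set mulAN p oneAN | p in lie_subgroup (s_alg w)].

End AN.

(* Main.v *)
(** In the chart (a, U, z) the metric reads
  da^2 + e^(-a) |dU|^2 + e^(-2a) theta^2 with theta = dz - <JU, dU> / 2,
  and W is the linear subspace {U in w}.  Along a geodesic leaving W
  orthogonally, e^(-2a) theta is conserved, hence theta = 0; then e^(-a) U' is
  constant and h = e^(-a/2) satisfies h'' = h / 4.  This gives
  a = a0 - 2 ln cosh (t/2) and U = U0 + 2 tanh (t/2) v with v normal to w, so
  the tube is the hypersurface |zeta|^2 = 4 sinh^2 (r/2) e^a, where zeta is the
  component of U in the orthogonal complement of w.

  Write J zeta = F + Q with F normal to w and Q in w.  On tangent vectors,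
  described by their g_alpha-component V and by y = theta, the shape operator is
  coth (r/2) / 2 for V normal to w, zeta and F, it is tanh (r/2) / 2 for V in
  (w orthogonal to Q) + R zeta, and it preserves the remaining span of F, Q and
  Z.  There the substitution
  l = - (coth (r/2) v - csch (r/2) sech (r/2) - 4 tanh (r/2)) / 6 turns the
  characteristic equation into v^3 - 3 v = beta, that is u^3 + u^(-3) = beta
  for v = u + 1/u. *)
Require Import Defs.
From HB Require Import structures.
From mathcomp Require Import all_boot all_order all_algebra.
From mathcomp Require Import all_classical all_reals all_analysis.
From mathcomp Require Import complex.
From mathcomp Require Import ring lra zify.
Import Order.TTheory GRing.Theory Num.Theory.
Import numFieldNormedType.Exports.
Local Open Scope classical_set_scope.
Local Open Scope ring_scope.

Set Implicit Arguments.
Unset Strict Implicit.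
Unset Printing Implicit Defensive.

(** * Euclidean preliminaries *)

(** The tube and the inward normal are both specified through all unit normal geodesics, so one
    explicit curve is not enough. Conservation of energy and of the momenta of the central and
    [g_alpha] directions yields the a- and U-components of every such geodesic, and theta = 0, with
    no uniqueness theorem for differential equations. Conversely, the resulting formulas are checked
    to define geodesics, which gives the other inclusion between tube and level set. The eigenvalue
    equation is solved for an arbitrary real l instead of diagonalising the shape operator. Away
    from tanh (r/2) / 2 and coth (r/2) / 2 it leaves one explicit direction and a scalar cubic in l.
    The base point enters only through e^(-a) |zeta|^2 = 4 sinh^2 (r/2), so the cubic is the same at
    all points of the tube; this is the constancy of the principal curvatures. The bounds on phi
    enter as sin phi and cos phi being nonzero: these make Q and F nonzero, keep the other two
    values from being roots of the cubic, and give -2 < beta < 2, hence three distinct real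
    roots. *)

Section Dot.
Variables (R : realType) (N : nat).
Implicit Types u v w : 'rV[R]_N.

Lemma dot_sum u v : dot u v = \sum_i u 0 i * v 0 i.
Proof. by rewrite /dot mxE; apply: eq_bigr => i _; rewrite mxE. Qed.

Lemma dotC u v : dot u v = dot v u.
Proof. by rewrite !dot_sum; apply: eq_bigr => i _; rewrite mulrC. Qed.

Lemma dotDl u v w : dot (u + v) w = dot u w + dot v w.
Proof. by rewrite /dot mulmxDl mxE. Qed.

Lemma dotZl c u w : dot (c *: u) w = c * dot u w.
Proof. by rewrite /dot -scalemxAl mxE. Qed.

Lemma dotDr u v w : dot w (u + v) = dot w u + dot w v.
Proof. by rewrite !(dotC w) dotDl. Qed.

Lemma dotZr c u w : dot w (c *: u) = c * dot w u.
Proof. by rewrite !(dotC w) dotZl. Qed.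

Lemma dot0l u : dot 0 u = 0.
Proof. by rewrite /dot mul0mx mxE. Qed.

Lemma dot0r u : dot u 0 = 0.
Proof. by rewrite dotC dot0l. Qed.

Lemma dotNl u w : dot (- u) w = - dot u w.
Proof. by rewrite -scaleN1r dotZl mulN1r. Qed.

Lemma dotNr u w : dot w (- u) = - dot w u.
Proof. by rewrite !(dotC w) dotNl. Qed.

Definition dotE := (dotDl, dotDr, dotNl, dotNr, dotZl, dotZr, dot0l, dot0r).

Lemma dot_ge0 u : 0 <= dot u u.
Proof. by rewrite dot_sum sumr_ge0// => i _; rewrite -expr2 sqr_ge0. Qed.

Lemma dot_eq0 u : dot u u = 0 -> u = 0.
Proof.
rewrite dot_sum => /eqP; rewrite psumr_eq0 => [/allP h|i _]; last first.
  by rewrite -expr2 sqr_ge0.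
apply/rowP => i; rewrite mxE; have := h i (mem_index_enum _).
by rewrite /= -expr2 sqrf_eq0 => /eqP.
Qed.

Lemma dot_gt0 u : u != 0 -> 0 < dot u u.
Proof.
by move=> u0; rewrite lt_def dot_ge0 andbT; apply: contra u0 => /eqP/dot_eq0 ->.
Qed.

Lemma dot_injr u v : (forall w, dot u w = dot v w) -> u = v.
Proof.
by move=> h; apply/subr0_eq/dot_eq0; rewrite dotDl dotNl h subrr.
Qed.

Lemma sqr_enorm u : enorm u ^+ 2 = dot u u.
Proof. by rewrite /enorm sqr_sqrtr// dot_ge0. Qed.

End Dot.

Section Jmx.
Variables (R : realType) (m : nat).
Implicit Types U V : 'rV[R]_(m + m).

Lemma JmxD U V : Jmx (U + V) = Jmx U + Jmx V.
Proof. by rewrite /Jmx add_row_mx -!raddfD/= !raddfD. Qed.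

Lemma JmxZ c U : Jmx (c *: U) = c *: Jmx U.
Proof. by rewrite /Jmx scale_row_mx !linearZ/= scalerN. Qed.

Lemma JmxN U : Jmx (- U) = - Jmx U.
Proof. by rewrite -scaleN1r JmxZ scaleN1r. Qed.

Lemma Jmx0 : Jmx (0 : 'rV[R]_(m + m)) = 0.
Proof. by rewrite -{1}(scale0r 0) JmxZ scale0r. Qed.

Lemma JmxK U : Jmx (Jmx U) = - U.
Proof. by rewrite /Jmx row_mxKl row_mxKr -{3}(hsubmxK U) opp_row_mx. Qed.

Lemma dot_row_mx (a b c d : 'rV[R]_m) :
  dot (row_mx a b) (row_mx c d) = dot a c + dot b d.
Proof. by rewrite /dot tr_row_mx mul_row_col mxE. Qed.

Lemma dotJJ U V : dot (Jmx U) (Jmx V) = dot U V.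
Proof.
by rewrite -{2}(hsubmxK U) -{2}(hsubmxK V) !dot_row_mx dotNl dotNr opprK addrC.
Qed.

Lemma dotJl U V : dot (Jmx U) V = - dot U (Jmx V).
Proof. by rewrite -dotJJ JmxK dotNl. Qed.

Lemma dotJ_antisym U V : dot (Jmx U) V = - dot (Jmx V) U.
Proof. by rewrite dotJl dotC. Qed.

Lemma dotJ_self U : dot (Jmx U) U = 0.
Proof. by have := dotJ_antisym U U; lra. Qed.

Definition JmxE := (JmxD, JmxN, JmxZ, Jmx0).

HB.instance Definition _ :=
  GRing.isLinear.Build R 'rV[R]_(m + m) 'rV[R]_(m + m) *:%R (@Jmx R m)
    (fun c U V => etrans (JmxD _ _) (congr1 (fun x => x + _) (JmxZ _ _))).

End Jmx.

(** * Calculus of directional derivatives *)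

Section DerivativeRules.
Variables (R : realType) (V : normedModType R).

(** Both sides are limits of the same difference quotient. Restricting to a line makes one-variable
    rules, such as the chain rule, available for derivatives along a vector. *)
Lemma is_derive_line (W : normedModType R) (f : V -> W) x v df :
  is_derive x v f df <-> is_derive (0 : R) 1 (fun t => f (t *: v + x)) df.
Proof.
have e : (fun h : R => h^-1 *: (((fun t : R => f (t *: v + x)) \o shift 0)
      (h *: (1 : R)) - f (0 *: v + x))) =
    (fun h : R => h^-1 *: ((f \o shift x) (h *: v) - f x)).
  by apply/funext => h /=; rewrite addr0 scale0r add0r [_ *: 1]mulr1.
by split=> -[h1 h2]; split; rewrite -1?h2 /derivable /derive e in h1 h2 *.
Qed.

Lemma linear_rV_continuous (W : normedModType R) N (f : {linear 'rV[R]_N -> W}) :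
  continuous f.
Proof.
have -> : (f : _ -> _) = fun x => \sum_(i < N) x 0 i *: f (delta_mx 0 i).
  apply/funext => x; rewrite {1}(row_sum_delta x) linear_sum.
  by apply: eq_bigr => i _; rewrite linearZ.
apply: (continuous_big (op := +%R)); first exact: add_continuous.
move=> i _ x.
have /= h := @coord_continuous R 1 N 0 i x; exact: (cvgZr_tmp h).
Qed.

Lemma is_derive_linear (W : normedModType R) N (f : {linear 'rV[R]_N -> W})
  (c : V -> 'rV[R]_N) x v dc :
  is_derive x v c dc -> is_derive x v (fun t => f (c t)) (f dc).
Proof.
move=> [h1 h2].
have h : (fun h : R => h^-1 *: (((fun t => f (c t)) \o shift x) (h *: v)
      - f (c x))) @ 0^' --> f dc.
  have -> : (fun h : R => h^-1 *: (((fun t => f (c t)) \o shift x) (h *: v)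
      - f (c x))) = f \o (fun h : R => h^-1 *: ((c \o shift x) (h *: v) - c x)).
    by apply/funext => h; rewrite /comp -linearB -linearZ_LR.
  apply: cvg_comp; last exact: linear_rV_continuous.
  by rewrite -h2; exact: h1.
split; first by apply/cvg_ex; exists (f dc).
by apply: cvg_lim.
Qed.

Lemma is_derive_comp1 (g : R -> R) (f : V -> R) x v df dg :
  is_derive x v f df -> is_derive (f x) 1 g dg ->
  is_derive x v (fun t => g (f t)) (df * dg).
Proof.
move=> /is_derive_line hf hg; apply/is_derive_line.
apply: is_derive_eq; last exact: mulrC.
have := @is_derive1_comp R g (fun t => f (t *: v + x)) 0 dg df.
by apply=> //; rewrite scale0r add0r.
Qed.

Lemma is_derive_addf (W : normedModType R) (f g : V -> W) (x v : V) df dg :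
  is_derive x v f df -> is_derive x v g dg ->
  is_derive x v (fun q => f q + g q) (df + dg).
Proof. exact: is_deriveD. Qed.

Lemma is_derive_oppf (W : normedModType R) (f : V -> W) (x v : V) df :
  is_derive x v f df -> is_derive x v (fun q => - f q) (- df).
Proof. exact: is_deriveN. Qed.

Lemma is_derive_subf (W : normedModType R) (f g : V -> W) (x v : V) df dg :
  is_derive x v f df -> is_derive x v g dg ->
  is_derive x v (fun q => f q - g q) (df - dg).
Proof. exact: is_deriveB. Qed.

Lemma is_derive_mulf (f g : V -> R) (x v : V) (df dg : R) :
  is_derive x v f df -> is_derive x v g dg ->
  is_derive x v (fun q => f q * g q) (df * g x + f x * dg).
Proof.
move=> hf hg; have -> : (fun q => f q * g q) = f * g by [].
apply: is_derive_eq.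
by rewrite addrC [_ *: df]mulrC.
Qed.

Lemma is_derive_cstf (W : normedModType R) (a : W) (x v : V) :
  is_derive x v (fun=> a) 0.
Proof. exact: is_derive_cst. Qed.

Lemma is_derive_mulcf (c : R) (f : V -> R) (x v : V) df :
  is_derive x v f df -> is_derive x v (fun q => c * f q) (c * df).
Proof. exact: is_deriveZ. Qed.

Lemma is_derive_idf (x v : V) : is_derive x v (fun q => q) v.
Proof. exact: is_derive_id. Qed.

Lemma is_derive_dot N (F G : V -> 'rV[R]_N) x v dF dG :
  is_derive x v F dF -> is_derive x v G dG ->
  is_derive x v (fun q => dot (F q) (G q)) (dot dF (G x) + dot (F x) dG).
Proof.
move=> hF hG.
have -> : (fun q => dot (F q) (G q)) =
    \sum_i ((fun q => F q 0 i) * (fun q => G q 0 i)).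
  by apply/funext => q; rewrite dot_sum fct_sumE.
have hc (c : V -> 'rV[R]_N) dc i : is_derive x v c dc ->
    is_derive x v (fun q => c q 0 i : R) (dc 0 i).
  move=> hc0.
  have := hc0.(ex_derive) => /[dup] /derive_mx e /derivable_mxP d.
  by split=> //; rewrite -(derive_val (is_derive := hc0)) e mxE.
apply: is_derive_eq.
rewrite !dot_sum -big_split; apply: eq_bigr => i _ /=.
by rewrite addrC; congr (_ + _); rewrite [_ *: _]mulrC.
Qed.

Lemma is_derive_scale (f : V -> R) N (a : 'rV[R]_N) x v df :
  is_derive x v f df -> is_derive x v (fun t => f t *: a) (df *: a).
Proof.
move=> [h1 h2].
have h : (fun h : R => h^-1 *: (((fun t => f t *: a) \o shift x) (h *: v)
      - f x *: a)) @ 0^' --> df *: a.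
  have -> : (fun h : R => h^-1 *: (((fun t => f t *: a) \o shift x) (h *: v)
      - f x *: a)) = (fun h : R => (h^-1 *: ((f \o shift x) (h *: v) - f x)) *: a).
    by apply/funext => h /=; rewrite -scalerBl scalerA.
  by apply: cvgZr_tmp; rewrite -h2; exact: h1.
split; first by apply/cvg_ex; exists (df *: a).
by apply: cvg_lim.
Qed.

End DerivativeRules.

(** Pairing with a fixed vector reduces the claim to real-valued functions. *)
Lemma rV_cst_of_derive0 (R : realType) N (c : R -> 'rV[R]_N) :
  (forall t : R, is_derive t (1 : R) c (0 : 'rV[R]_N)) -> forall s t, c s = c t.
Proof.
move=> hc s t; apply: dot_injr => w.
apply: (@is_derive_0_is_cst _ (fun t => dot (c t) w)) => x.
apply: is_derive_eq; first exact: (is_derive_dot (hc x) (is_derive_cst w x 1)).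
by rewrite dot0l dot0r addr0.
Qed.

Lemma is_derive_lfun (R : realType) (V : normedModType R) N M
    (P : 'Hom('rV[R]_N, 'rV[R]_M)) (c : V -> 'rV[R]_N) (x v : V) dc :
  is_derive x v c dc -> is_derive x v (fun t => P (c t)) (P dc).
Proof. exact: is_derive_linear. Qed.

Lemma differentiable_linear_rV (R : realType) N (W : normedModType R)
    (f : {linear 'rV[R]_N -> W}) x : differentiable f x.
Proof. exact: (linear_differentiable x (linear_rV_continuous (f := f))). Qed.

(** * The metric in the global chart *)

Section Chart.
Variables (R : realType) (n : nat).
Local Notation D := (n.-1 + n.-1)%N.
Local Notation pt := 'rV[R]_(1 + (n.-1 + n.-1) + 1).
Implicit Types (p q u v l : pt) (U W : 'rV[R]_(n.-1 + n.-1)).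

Lemma a_part_mk (a z : R) U : a_part (mkAN a U z) = a.
Proof. by rewrite /a_part /mkAN !row_mxKl mxE eqxx mulr1n. Qed.

Lemma alpha_part_mk (a z : R) U : alpha_part (mkAN a U z) = U.
Proof. by rewrite /alpha_part /mkAN row_mxKl row_mxKr. Qed.

Lemma z_part_mk (a z : R) U : z_part (mkAN a U z) = z.
Proof. by rewrite /z_part /mkAN row_mxKr mxE eqxx mulr1n. Qed.

Definition partsE := (a_part_mk, alpha_part_mk, z_part_mk).

Lemma mkAN_parts p : mkAN (a_part p) (alpha_part p) (z_part p) = p.
Proof. by rewrite /mkAN -!mx11_scalar !hsubmxK. Qed.

Lemma AN_ext p q : a_part p = a_part q -> alpha_part p = alpha_part q ->
  z_part p = z_part q -> p = q.
Proof. by move=> h1 h2 h3; rewrite -(mkAN_parts p) h1 h2 h3 mkAN_parts. Qed.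

Fact a_part_is_linear : linear (@a_part R n : pt -> R).
Proof. by move=> c p q; rewrite /a_part !linearP/= !mxE. Qed.
Fact alpha_part_is_linear : linear (@alpha_part R n : pt -> 'rV[R]_D).
Proof. by move=> c p q; rewrite /alpha_part !linearP. Qed.
Fact z_part_is_linear : linear (@z_part R n : pt -> R).
Proof. by move=> c p q; rewrite /z_part !linearP/= !mxE. Qed.

HB.instance Definition _ :=
  GRing.isLinear.Build R pt R _ (@a_part R n) a_part_is_linear.
HB.instance Definition _ :=
  GRing.isLinear.Build R pt 'rV[R]_D _ (@alpha_part R n) alpha_part_is_linear.
HB.instance Definition _ :=
  GRing.isLinear.Build R pt R _ (@z_part R n) z_part_is_linear.

Lemma a_partD p q : a_part (p + q : pt) = a_part p + a_part q.
Proof. exact: linearD. Qed.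
Lemma alpha_partD p q : alpha_part (p + q : pt) = alpha_part p + alpha_part q.
Proof. exact: linearD. Qed.
Lemma z_partD p q : z_part (p + q : pt) = z_part p + z_part q.
Proof. exact: linearD. Qed.
Lemma a_partZ c p : a_part (c *: p : pt) = c * a_part p.
Proof. exact: linearZ. Qed.
Lemma alpha_partZ c p : alpha_part (c *: p : pt) = c *: alpha_part p.
Proof. exact: linearZ. Qed.
Lemma z_partZ c p : z_part (c *: p : pt) = c * z_part p.
Proof. exact: linearZ. Qed.
Lemma a_partN p : a_part (- p : pt) = - a_part p.
Proof. exact: linearN. Qed.
Lemma alpha_partN p : alpha_part (- p : pt) = - alpha_part p.
Proof. exact: linearN. Qed.
Lemma z_partN p : z_part (- p : pt) = - z_part p.
Proof. exact: linearN. Qed.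
Lemma a_part0 : a_part (0 : pt) = 0.
Proof. exact: linear0. Qed.
Lemma alpha_part0 : alpha_part (0 : pt) = 0.
Proof. exact: linear0. Qed.
Lemma z_part0 : z_part (0 : pt) = 0.
Proof. exact: linear0. Qed.

Definition partE := (partsE, (a_partD, alpha_partD, z_partD),
  (a_partZ, alpha_partZ, z_partZ), (a_partN, alpha_partN, z_partN),
  (a_part0, alpha_part0, z_part0)).

Lemma dot_parts p q : dot p q =
  a_part p * a_part q + dot (alpha_part p) (alpha_part q)
  + z_part p * z_part q.
Proof.
rewrite -{1}(hsubmxK p) -{1}(hsubmxK q) /dot tr_row_mx mul_row_col mxE.
rewrite -{1}(hsubmxK (lsubmx p)) -{1}(hsubmxK (lsubmx q)).
rewrite tr_row_mx mul_row_col mxE; congr (_ + _ + _).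
  by rewrite mxE big_ord1 !mxE /a_part !mxE.
by rewrite mxE big_ord1 !mxE /z_part !mxE.
Qed.

Fact alpha_inj_is_linear : linear (fun U => mkAN 0 U 0 : pt).
Proof.
by move=> c U W; apply: AN_ext; rewrite !partE ?mulr0 ?addr0.
Qed.
Definition alpha_inj U : pt := mkAN 0 U 0.
HB.instance Definition _ :=
  GRing.isLinear.Build R 'rV[R]_D pt _ alpha_inj alpha_inj_is_linear.

Lemma mkAN_decomp (a z : R) U :
  mkAN a U z = a *: (mkAN 1 0 0 : pt) + alpha_inj U + z *: (mkAN 0 0 1 : pt).
Proof.
by apply: AN_ext; rewrite !partE ?mulr0 ?mulr1 ?scaler0 ?addr0 ?add0r.
Qed.

Lemma is_derive_mkAN (V : normedModType R) (f k : V -> R) (G : V -> 'rV[R]_D)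
    (x v : V) df dG dk :
  is_derive x v f df -> is_derive x v G dG -> is_derive x v k dk ->
  is_derive x v (fun t => mkAN (f t) (G t) (k t) : pt) (mkAN df dG dk).
Proof.
move=> hf hG hk.
have -> : (fun t => mkAN (f t) (G t) (k t) : pt) =
   fun t => f t *: (mkAN 1 0 0 : pt) + alpha_inj (G t) + k t *: (mkAN 0 0 1 : pt).
  by apply/funext => t; rewrite mkAN_decomp.
rewrite (mkAN_decomp df).
exact: (is_derive_addf (is_derive_addf (is_derive_scale _ hf)
  (is_derive_linear alpha_inj hG)) (is_derive_scale _ hk)).
Qed.

Lemma is_derive_a_part (V : normedModType R) (c : V -> pt) (x v : V) dc :
  is_derive x v c dc -> is_derive x v (fun t => a_part (c t)) (a_part dc).
Proof. exact: is_derive_linear. Qed.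
Lemma is_derive_alpha_part (V : normedModType R) (c : V -> pt) (x v : V) dc :
  is_derive x v c dc ->
  is_derive x v (fun t => alpha_part (c t)) (alpha_part dc).
Proof. exact: is_derive_linear. Qed.
Lemma is_derive_z_part (V : normedModType R) (c : V -> pt) (x v : V) dc :
  is_derive x v c dc -> is_derive x v (fun t => z_part (c t)) (z_part dc).
Proof. exact: is_derive_linear. Qed.
Lemma is_derive_Jmx (V : normedModType R) m (c : V -> 'rV[R]_(m + m)) (x v : V) dc :
  is_derive x v c dc -> is_derive x v (fun t => Jmx (c t)) (Jmx dc).
Proof. exact: is_derive_linear. Qed.

(* e^a times the Z-component of [v] in the left-invariant frame at [p]. *)
Definition theta p v : R :=
  z_part v - 2^-1 * dot (Jmx (alpha_part p)) (alpha_part v).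

(** Left translation by a fixed element is affine in the chart, so its derivative is its linear
    part: the left-invariant coframe da, e^(-a/2) dU, e^(-a) theta. *)
Lemma is_derive_mulAN_inv p v : is_derive p v (mulAN (invAN p) : pt -> pt)
  (mkAN (a_part v) (expR (- (a_part p / 2)) *: alpha_part v)
    (expR (- a_part p) * theta p v)).
Proof.
have -> : (mulAN (invAN p) : pt -> pt) = fun q =>
    mkAN (a_part q - a_part p)
      (expR (- (a_part p / 2)) *: (alpha_part q - alpha_part p))
      (expR (- a_part p) * (z_part q - z_part p
         - 2^-1 * dot (Jmx (alpha_part p)) (alpha_part q))).
  apply/funext => q; apply: AN_ext; rewrite /mulAN /invAN !partE.
  - by rewrite addrC.
  - by rewrite mulNr scaleNr addrC scalerBr.
  - rewrite !JmxE !dotE mulNr.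
    have -> : expR (- a_part p) = expR (- (a_part p / 2)) ^+ 2.
      by rewrite expr2 -expRD; congr expR; lra.
    ring.
have hid := is_derive_idf p v.
have ha := is_derive_subf (is_derive_a_part hid)
  (is_derive_cstf (a_part p) p v).
have hU := is_derive_subf (is_derive_alpha_part hid)
  (is_derive_cstf (alpha_part p) p v).
have hz := is_derive_subf (is_derive_z_part hid)
  (is_derive_cstf (z_part p) p v).
have hd := is_derive_mulcf 2^-1 (is_derive_dot
  (is_derive_cstf (Jmx (alpha_part p)) p v) (is_derive_alpha_part hid)).
have := is_derive_mkAN ha (is_deriveZ _ hU)
  (is_derive_mulcf (expR (- a_part p)) (is_derive_subf hz hd)).
by rewrite !subr0 dot0l add0r; apply.
Qed.

Lemma gANE p u v : gAN p u v = a_part u * a_part v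
  + expR (- a_part p) * dot (alpha_part u) (alpha_part v)
  + expR (- a_part p) ^+ 2 * (theta p u * theta p v).
Proof.
rewrite /gAN (derive_val (is_derive := is_derive_mulAN_inv p u)).
rewrite (derive_val (is_derive := is_derive_mulAN_inv p v)).
rewrite dot_parts !partE !dotE.
have -> : expR (- a_part p) = expR (- (a_part p / 2)) ^+ 2.
  by rewrite expr2 -expRD; congr expR; lra.
ring.
Qed.

Lemma thetaDr p u v : theta p (u + v) = theta p u + theta p v.
Proof. by rewrite /theta !partE dotDr; ring. Qed.
Lemma thetaZr p c v : theta p (c *: v) = c * theta p v.
Proof. by rewrite /theta !partE dotZr; ring. Qed.
Lemma theta_mk p (a z : R) U :
  theta p (mkAN a U z) = z - 2^-1 * dot (Jmx (alpha_part p)) U.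
Proof. by rewrite /theta !partsE. Qed.

Lemma gANC p u v : gAN p u v = gAN p v u.
Proof. by rewrite !gANE (dotC (alpha_part u)); ring. Qed.

Lemma gANDl p u v l : gAN p (u + v) l = gAN p u l + gAN p v l.
Proof. by rewrite !gANE !partE !dotE thetaDr; ring. Qed.

Lemma gANZl p c u l : gAN p (c *: u) l = c * gAN p u l.
Proof. by rewrite !gANE !partE !dotE thetaZr; ring. Qed.

(** Three nonnegative terms add up to 0. The U-component must be killed first; only then does
    [theta p u] reduce to [z_part u]. *)
Lemma gAN_eq0 p u : gAN p u u = 0 -> u = 0.
Proof.
rewrite gANE.
have e0 := expR_gt0 (- a_part p); have d0 := dot_ge0 (alpha_part u).
move=> h.
have ha : a_part u = 0 by nra.
have hd : dot (alpha_part u) (alpha_part u) = 0.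
  apply/eqP; rewrite eq_le d0 andbT.
  by rewrite -(ler_pM2l e0) mulr0; nra.
have {hd}ha' := dot_eq0 hd.
have ht : theta p u = 0.
  have : theta p u * theta p u = 0.
    have e1 : 0 < expR (- a_part p) ^+ 2 by rewrite exprn_gt0.
    apply: (mulfI (lt0r_neq0 e1)); rewrite mulr0.
    by move: h; rewrite ha ha' dot0l; lra.
  by move/eqP; rewrite mulf_eq0 orbb => /eqP.
move: ht; rewrite /theta ha' dot0r mulr0 subr0 => hz.
by apply: AN_ext; rewrite partE.
Qed.

Lemma mulmx_gram p u : u *m gram (@gAN R n) p = \row_l gAN p u (delta_mx 0 l).
Proof.
apply/rowP => l; rewrite !mxE {2}(row_sum_delta u).
rewrite (big_morph (fun x => gAN p x (delta_mx 0 l)) (id1 := 0) (op1 := +%R)).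
- by apply: eq_bigr => i _; rewrite mxE gANZl.
- by move=> x y; rewrite gANDl.
- by rewrite -(scale0r 0) gANZl mul0r.
Qed.

Lemma gram_unit p : gram (@gAN R n) p \in unitmx.
Proof.
rewrite -row_free_unit; apply: inj_row_free => u.
rewrite mulmx_gram => /rowP h; apply: (@gAN_eq0 p).
rewrite {2}(row_sum_delta u) gANC.
rewrite (big_morph (fun x => gAN p x u) (id1 := 0) (op1 := +%R)).
- rewrite big1// => i _; rewrite gANZl gANC.
  by have := h i; rewrite !mxE => ->; rewrite mulr0.
- by move=> x y; rewrite gANDl.
- by rewrite -(scale0r 0) gANZl mul0r.
Qed.

(** Koszul's formula with the index lowered: as the Gram matrix is invertible, a candidate [G] only
    has to be tested against all [l], and no inverse matrix is computed. *)
Lemma christoffel_unique p u v G (du dv duv : pt -> R) :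
  (forall l, 'D_u (fun q => gAN q v l) p = du l) ->
  (forall l, 'D_v (fun q => gAN q u l) p = dv l) ->
  (forall l, 'D_l (fun q => gAN q u v) p = duv l) ->
  (forall l, gAN p G l = 2^-1 * (du l + dv l - duv l)) ->
  christoffel (@gAN R n) p u v = G.
Proof.
move=> hu hv huv h.
rewrite /christoffel -[RHS](mulmxK (gram_unit p)) mulmx_gram.
by congr (_ *m _); apply/rowP => l; rewrite !mxE h -hu -hv -huv.
Qed.

Lemma is_derive_theta p v l : is_derive p v (fun q => theta q l)
  (- (2^-1 * dot (Jmx (alpha_part v)) (alpha_part l))).
Proof.
have hid := is_derive_idf p v.
have := is_derive_subf (is_derive_cstf (z_part l) p v)
  (is_derive_mulcf 2^-1 (is_derive_dot (is_derive_Jmx (is_derive_alpha_part hid))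
     (is_derive_cstf (alpha_part l) p v))).
by rewrite dot0r addr0 sub0r.
Qed.

Lemma is_derive_expRN p v : is_derive p v (fun q : pt => expR (- a_part q))
  (- (a_part v * expR (- a_part p))).
Proof.
have h : is_derive p v (fun q : pt => - a_part q) (- a_part v).
  by apply: is_deriveN; apply: is_derive_a_part; exact: is_derive_idf.
by have := is_derive_comp1 h (is_derive_expR _); rewrite mulNr.
Qed.

Lemma derive_gAN p u v l : 'D_u (fun q => gAN q v l) p =
  - (a_part u * expR (- a_part p)) * dot (alpha_part v) (alpha_part l)
  - 2 * a_part u * expR (- a_part p) ^+ 2 * (theta p v * theta p l)
  - 2^-1 * expR (- a_part p) ^+ 2 *
    (dot (Jmx (alpha_part u)) (alpha_part v) * theta p l
     + theta p v * dot (Jmx (alpha_part u)) (alpha_part l)).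
Proof.
have he := is_derive_expRN p u.
have hv := is_derive_theta p u v.
have hl := is_derive_theta p u l.
have -> : (fun q => gAN q v l) = fun q => a_part v * a_part l
   + dot (alpha_part v) (alpha_part l) * expR (- a_part q)
   + (expR (- a_part q) * expR (- a_part q)) * (theta q v * theta q l).
  by apply/funext => q; rewrite gANE expr2 [_ * dot _ _]mulrC.
have h := is_derive_addf (is_derive_addf
  (is_derive_cstf (a_part v * a_part l) p u)
  (is_derive_mulcf (dot (alpha_part v) (alpha_part l)) he))
  (is_derive_mulf (is_derive_mulf he he) (is_derive_mulf hv hl)).
by rewrite (derive_val (is_derive := h)); ring.
Qed.

Definition christoffel_a p u v : R :=
  2^-1 * (expR (- a_part p) * dot (alpha_part u) (alpha_part v))
  + expR (- a_part p) ^+ 2 * (theta p u * theta p v).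

Definition christoffel_alpha p u v : 'rV[R]_D :=
  - 2^-1 *: (a_part u *: alpha_part v + a_part v *: alpha_part u
    + expR (- a_part p) *: (theta p v *: Jmx (alpha_part u)
                            + theta p u *: Jmx (alpha_part v))).

(** The components come from solving the lowered identity along da, dU and theta in turn. The first
    summand of the z-component is the difference between dz and theta; [theta p] of the whole is
    what follows it. *)
Lemma christoffel_AN p u v : christoffel (@gAN R n) p u v =
  mkAN (christoffel_a p u v) (christoffel_alpha p u v)
    (2^-1 * dot (Jmx (alpha_part p)) (christoffel_alpha p u v)
     - (a_part u * theta p v + a_part v * theta p u)).
Proof.
apply: (christoffel_unique (derive_gAN p u v) (derive_gAN p v u)
  (fun l => derive_gAN p l u v)) => l.
rewrite gANE.
rewrite theta_mk a_part_mk alpha_part_mk.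
rewrite /christoffel_a /christoffel_alpha.
rewrite !dotE (dotJ_antisym (alpha_part v) (alpha_part u)).
rewrite (dotJ_antisym (alpha_part l) (alpha_part u)).
rewrite (dotJ_antisym (alpha_part l) (alpha_part v)).
rewrite ?(dotC (alpha_part v) (alpha_part u)).
by field.
Qed.

End Chart.

(** * Orthogonal complements *)

Lemma dim_rV (R : realType) (N : nat) : \dim {:'rV[R]_N} = N.
Proof. by rewrite dimvf dim_matrix; exact: mul1n. Qed.

Section OrthogonalComplement.
Variables (R : realType) (N : nat).
Implicit Types (V : {vspace 'rV[R]_N}) (x y : 'rV[R]_N).

Section Coordinates.
Variable V : {vspace 'rV[R]_N}.
Let coords x : 'rV[R]_(\dim V) := \row_i dot x (vbasis V)`_i.
Fact coords_is_linear : linear coords.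
Proof. by move=> c x y; apply/rowP => i; rewrite !mxE !dotE. Qed.
HB.instance Definition _ :=
  GRing.isLinear.Build R 'rV[R]_N 'rV[R]_(\dim V) _ coords coords_is_linear.

(** Written as a kernel, so that rank-nullity bounds its dimension from below. *)
Definition orthv : {vspace 'rV[R]_N} := lker (linfun coords).

Lemma memv_orthv x : reflect (forall y, y \in V -> dot x y = 0) (x \in orthv).
Proof.
rewrite memv_ker lfunE /=; apply: (iffP eqP) => [h y yV|h].
  rewrite (coord_vbasis yV).
  rewrite (big_morph (dot x) (id1 := 0) (op1 := +%R)).
  - rewrite big1// => i _; rewrite dotZr; move/rowP: h => /(_ i).
    by rewrite !mxE => ->; rewrite mulr0.
  - by move=> ? ?; rewrite dotDr.
  - by rewrite dot0r.
apply/rowP => i; rewrite !mxE h// memvE -memvE.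
by apply: vbasis_mem; rewrite mem_nth// size_tuple.
Qed.

Lemma dimv_orthv_ge : (N <= \dim V + \dim orthv)%N.
Proof.
have := limg_ker_dim (linfun coords) fullv.
rewrite capfv dim_rV => {1}<-.
rewrite addnC leq_add2r.
have := dimvS (subvf (linfun coords @: fullv)%VS).
by rewrite dim_rV.
Qed.
End Coordinates.

Lemma cap_orthv V : (V :&: orthv V)%VS = 0%VS.
Proof.
apply/eqP; rewrite -subv0; apply/subvP => x; rewrite memv_cap memv0.
by case/andP => xV /memv_orthv h; apply/eqP/dot_eq0/h.
Qed.

Lemma add_orthv V : (V + orthv V)%VS = fullv.
Proof.
apply/eqP; rewrite eqEdim subvf /= dimv_disjoint_sum ?cap_orthv//.
by rewrite dim_rV dimv_orthv_ge.
Qed.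

Lemma dimv_orthv V : (\dim V + \dim (orthv V) = N)%N.
Proof.
by rewrite -dimv_disjoint_sum ?cap_orthv// add_orthv dim_rV.
Qed.

Definition orthproj V : 'End('rV[R]_N) := daddv_pi V (orthv V).

Lemma memv_orthproj V x : orthproj V x \in V.
Proof. exact: memv_pi. Qed.

Lemma sub_orthproj V x : x - orthproj V x \in orthv V.
Proof.
have := daddv_pi_add (cap_orthv V) (_ : x \in (V + orthv V)%VS).
rewrite add_orthv memvf => /(_ isT) {1}<-.
by rewrite addrC addKr memv_pi.
Qed.

Lemma dot_orthproj V x y : dot (orthproj V x) y = dot (orthproj V x) (orthproj V y).
Proof.
rewrite -{1}(subrK (orthproj V y) y) dotDr (dotC (orthproj V x)).
have /memv_orthv -> := sub_orthproj V y; first by rewrite add0r.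
exact: memv_orthproj.
Qed.

Lemma dot_orthprojC V x y : dot (orthproj V x) y = dot x (orthproj V y).
Proof. by rewrite dot_orthproj dotC -dot_orthproj dotC. Qed.

Lemma orthproj_id V x : x \in V -> orthproj V x = x.
Proof. by move=> xV; rewrite /orthproj daddv_pi_id// cap_orthv. Qed.

Lemma orthproj_eq0 V x : (orthproj V x == 0) = (x \in orthv V).
Proof.
apply/eqP/idP => [h|/memv_orthv h]; first by rewrite -(subr0 x) -h sub_orthproj.
apply: dot_eq0; rewrite dot_orthprojC orthproj_id ?memv_orthproj//.
by rewrite h ?memv_orthproj.
Qed.

Lemma orthvK V : orthv (orthv V) = V.
Proof.
apply/eqP; rewrite eq_sym eqEdim; apply/andP; split.
  by apply/subvP => x xV; apply/memv_orthv => y /memv_orthv h; rewrite dotC h.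
by rewrite -(leq_add2l (\dim (orthv V))) dimv_orthv addnC dimv_orthv.
Qed.

(** Subtracting the projection onto the line of [a] does not leave [V], so [V] is the direct sum of
    that line and its complement inside [V]. *)
Lemma dimv_cap_line V a : a \in V -> a != 0 ->
  \dim (V :&: orthv <[a]>) = (\dim V).-1.
Proof.
move=> aV a0.
have e : (<[a]> + (V :&: orthv <[a]>))%VS = V.
  apply/eqP; rewrite eqEsubv; apply/andP; split.
    by rewrite subv_add -memvE aV capvSl.
  apply/subvP => x xV; rewrite -(subrK (orthproj <[a]> x) x) addrC.
  apply: memv_add; first exact: memv_orthproj.
  rewrite memv_cap sub_orthproj andbT rpredB//.
  have /vlineP[c ->] := memv_orthproj <[a]> x.
  by rewrite rpredZ.
have := dimv_disjoint_sum (_ : <[a]> :&: (V :&: orthv <[a]>) = 0)%VS.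
rewrite e dim_vline a0 => -> //.
by rewrite capvC -capvA (capvC (orthv _)) cap_orthv capv0.
Qed.

Lemma memv_orth_line a x : (x \in orthv <[a]>) = (dot x a == 0).
Proof.
apply/memv_orthv/eqP => [h|h y /vlineP[c ->]]; first by rewrite h ?memv_line.
by rewrite dotZr h mulr0.
Qed.

Lemma orthprojD V x y : orthproj V (x + y) = orthproj V x + orthproj V y.
Proof. exact: linearD. Qed.

Lemma orthprojZ V a x : orthproj V (a *: x) = a *: orthproj V x.
Proof. exact: linearZ. Qed.

End OrthogonalComplement.

(** * Hyperbolic functions *)

Section Hyperbolic.
Variable R : realType.
Implicit Types x t : R.

Lemma cosh_gt0 x : 0 < cosh x.
Proof. by rewrite /cosh divr_gt0// addr_gt0// expR_gt0. Qed.

Lemma cosh_neq0 x : cosh x != 0.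
Proof. exact/lt0r_neq0/cosh_gt0. Qed.

Lemma coshD_sinh x : cosh x + sinh x = expR x.
Proof. by rewrite /cosh /sinh; field. Qed.

Lemma coshB_sinh x : cosh x - sinh x = expR (- x).
Proof. by rewrite /cosh /sinh; field. Qed.

Lemma cosh2B_sinh2 x : cosh x ^+ 2 - sinh x ^+ 2 = 1.
Proof.
by rewrite subr_sqr coshD_sinh coshB_sinh -expRD addNr expR0.
Qed.

Lemma sinh_gt0 x : 0 < x -> 0 < sinh x.
Proof.
by move=> x0; rewrite /sinh divr_gt0// subr_gt0 ltr_expR; lra.
Qed.

Lemma cosh0 : cosh (0 : R) = 1.
Proof. by rewrite /cosh oppr0 expR0; lra. Qed.

Lemma sinh0 : sinh (0 : R) = 0.
Proof. by rewrite /sinh oppr0 expR0; lra. Qed.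

Lemma tanh0 : tanh (0 : R) = 0.
Proof. by rewrite /tanh sinh0 mul0r. Qed.

Lemma is_derive_half t : is_derive t 1 (fun s : R => s / 2) 2^-1.
Proof.
have := is_derive_mulcf 2^-1 (is_derive_idf t (1 : R)).
rewrite mulr1; have -> // : (fun q : R => 2^-1 * q) = fun s => s / 2.
by apply/funext => q; rewrite mulrC.
Qed.

Lemma is_derive_expR_half t : is_derive t 1 (fun s : R => expR (s / 2))
  (expR (t / 2) / 2).
Proof.
by have := is_derive_comp1 (is_derive_half t) (is_derive_expR _); rewrite mulrC.
Qed.

Lemma is_derive_expRN_half t : is_derive t 1 (fun s : R => expR (- (s / 2)))
  (- (expR (- (t / 2)) / 2)).
Proof.
have := is_derive_comp1 (is_derive_oppf (is_derive_half t)) (is_derive_expR _).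
by rewrite mulNr [_ * expR _]mulrC.
Qed.

Lemma is_derive_cosh_half t : is_derive t 1 (fun s : R => cosh (s / 2))
  (sinh (t / 2) / 2).
Proof.
have := is_derive_mulcf 2^-1 (is_derive_addf (is_derive_expR_half t)
   (is_derive_expRN_half t)).
have -> : (fun q : R => 2^-1 * (expR (q / 2) + expR (- (q / 2)))) =
   fun s => cosh (s / 2) by apply/funext => q; rewrite /cosh mulrC.
by move/is_derive_eq; apply; rewrite /sinh; field.
Qed.

Lemma is_derive_sinh_half t : is_derive t 1 (fun s : R => sinh (s / 2))
  (cosh (t / 2) / 2).
Proof.
have := is_derive_mulcf 2^-1 (is_derive_subf (is_derive_expR_half t)
   (is_derive_expRN_half t)).
have -> : (fun q : R => 2^-1 * (expR (q / 2) - expR (- (q / 2)))) =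
   fun s => sinh (s / 2) by apply/funext => q; rewrite /sinh mulrC.
by move/is_derive_eq; apply; rewrite /cosh; field.
Qed.

Lemma is_derive_sech_half t : is_derive t 1 (fun s : R => (cosh (s / 2))^-1)
  (- (sinh (t / 2) / cosh (t / 2) ^+ 2 / 2)).
Proof.
have [h1 h2] := is_derive_cosh_half t; have c0 := cosh_neq0 (t / 2).
split; first exact: derivableV.
rewrite deriveV// h2.
change (- cosh (t / 2) ^- 2 * (sinh (t / 2) / 2) =
  - (sinh (t / 2) / cosh (t / 2) ^+ 2 / 2)).
by field.
Qed.

Lemma is_derive_tanh_half t : is_derive t 1 (fun s : R => tanh (s / 2))
  ((cosh (t / 2) ^+ 2)^-1 / 2).
Proof.
have := is_derive_mulf (is_derive_sinh_half t) (is_derive_sech_half t).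
move/is_derive_eq; apply; have e := cosh2B_sinh2 (t / 2).
have -> : sinh (t / 2) * - (sinh (t / 2) / cosh (t / 2) ^+ 2 / 2) =
  - ((cosh (t / 2) ^+ 2 - 1) / cosh (t / 2) ^+ 2 / 2).
  by rewrite -[X in _ - X]e; ring.
by field; rewrite cosh_neq0.
Qed.

Lemma is_derive_lncosh_half t : is_derive t 1 (fun s : R => ln (cosh (s / 2)))
  (tanh (t / 2) / 2).
Proof.
have := is_derive_comp1 (is_derive_cosh_half t)
  (is_derive1_ln (cosh_gt0 (t / 2))).
by move/is_derive_eq; apply; rewrite /tanh; field; rewrite cosh_neq0.
Qed.

End Hyperbolic.

(** * The submanifold W and its normal geodesics *)

Section Subgroup.
Variables (R : realType) (n : nat).
Local Notation D := (n.-1 + n.-1)%N.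
Local Notation pt := 'rV[R]_(1 + (n.-1 + n.-1) + 1).
Variable w : {vspace 'rV[R]_(n.-1 + n.-1)}.

Definition alpha_sub : set (AN R n) := [set p | alpha_part p \in w].

Lemma alpha_sub_subgroup : is_subgroup alpha_sub.
Proof.
split; rewrite /alpha_sub /=.
- by rewrite /oneAN partsE mem0v.
- by move=> p q hp hq; rewrite /mulAN partsE rpredD// rpredZ.
- by move=> p hp; rewrite /invAN partsE rpredZ.
Qed.

(** Differentiability is given only at 0. By the homomorphism law the component orthogonal to [w] at
    time s + u is affine in the one at time u, so its derivative at every s is a multiple of the
    derivative at 0, which vanishes. *)
Lemma one_param_alpha (c : R -> AN R n) : one_param_subgroup c ->
  alpha_part (derive1 c 0) \in w -> forall t, alpha_part (c t) \in w.
Proof.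
move=> [dc hc] hw t.
(* [c 0] is idempotent, which forces its a- and U-components to vanish and supplies the initial
   value. *)
have a0 : a_part (c 0) = 0.
  have := congr1 (@a_part R n) (hc 0 0); rewrite addr0 /mulAN partsE; lra.
have al0 : alpha_part (c 0) = 0.
  have := congr1 (@alpha_part R n) (hc 0 0).
  rewrite addr0 /mulAN partsE a0 mul0r expR0 scale1r.
  by move/(congr1 (fun x => x - alpha_part (c 0))); rewrite subrr addrK.
pose P := orthproj (orthv w).
have hP x : (x \in w) = (P x == 0) by rewrite /P orthproj_eq0 orthvK.
have hPc s u : P (alpha_part (c (s + u))) =
    P (alpha_part (c s)) + expR (a_part (c s) / 2) *: P (alpha_part (c u)).
  by rewrite hc /mulAN partsE linearD linearZ.
have dc0 : is_derive (0 : R) (1 : R) (c : R -> pt) (derive1 c 0).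
  exact: DeriveDef dc (esym (derive1E _ _)).
have dP0 : is_derive (0 : R) (1 : R) (fun u => P (alpha_part (c u))) 0.
  have := is_derive_lfun P (is_derive_alpha_part dc0).
  by move: hw; rewrite hP => /eqP ->.
have dP s : is_derive s (1 : R) (fun u => P (alpha_part (c u))) 0.
  apply/is_derive_line.
  have -> : (fun t0 : R => P (alpha_part (c (t0 *: (1 : R) + s)))) =
     fun u => P (alpha_part (c s))
       + expR (a_part (c s) / 2) *: P (alpha_part (c u)).
    by apply/funext => u; rewrite -hPc [u *: _]mulr1 addrC.
  have := is_derive_addf (is_derive_cstf (P (alpha_part (c s))) (0 : R) (1 : R))
    (is_deriveZ (expR (a_part (c s) / 2)) dP0).
  by rewrite scaler0 addr0.
rewrite hP (rV_cst_of_derive0 dP t 0) al0 linear0; exact: eqxx.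
Qed.

Lemma one_param_a : one_param_subgroup (fun t => mkAN t 0 0 : AN R n).
Proof.
split.
  have := is_derive_mkAN (is_derive_idf (0 : R) 1)
    (is_derive_cstf (0 : 'rV[R]_D) (0 : R) 1) (is_derive_cstf (0 : R) (0 : R) 1).
  by case.
move=> s t; apply: AN_ext; rewrite /mulAN !partsE ?scaler0 ?addr0//.
by rewrite !JmxE !dotE; ring.
Qed.

Lemma one_param_n (U : 'rV[R]_D) z :
  one_param_subgroup (fun t => mkAN 0 (t *: U) (t * z) : AN R n).
Proof.
split.
  have := is_derive_mkAN (is_derive_cstf (0 : R) (0 : R) 1)
    (is_derive_scale U (is_derive_idf (0 : R) 1))
    (is_derive_mulf (is_derive_idf (0 : R) 1) (is_derive_cstf z (0 : R) 1)).
  by case.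
move=> s t; apply: AN_ext; rewrite /mulAN !partsE ?addr0//.
  by rewrite mul0r expR0 scale1r scalerDl.
by rewrite !JmxE !dotE dotJ_self mul0r expR0; ring.
Qed.

Lemma mulAN1 (p : AN R n) : mulAN p (oneAN R n) = p.
Proof.
apply: AN_ext; rewrite /mulAN /oneAN !partsE ?scaler0 ?addr0 ?mulr0//.
by rewrite dot0r mulr0 !addr0.
Qed.

(** One inclusion holds because [alpha_sub w] is a subgroup containing the generators, the other
    because each of its points is a product of two exponentials. *)
Lemma WphiE : Wphi w = alpha_sub.
Proof.
apply/seteqP; split => p.
  move=> [q hq <-].
  rewrite mulAN1; apply: hq; first exact: alpha_sub_subgroup.
  exact: one_param_alpha.
rewrite /alpha_sub /= => hp.
exists p; last exact: mulAN1.
move=> H [_ hM _] he.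
(* The chart is the factorization Exp (U + z Z) Exp (a B); the unit factors exhibit the first
   exponential as the value at time 1 of a one-parameter subgroup. *)
have -> : p = mulAN (mkAN 0 (1 *: alpha_part p) (1 * z_part p))
    (mkAN (a_part p) 0 0).
  by apply: AN_ext; rewrite /mulAN !partsE ?scaler0 ?add0r ?addr0 ?scale1r//
    dot0r; ring.
apply: hM.
- apply: (he _ (one_param_n _ _)); rewrite /s_alg /= derive1E.
  have h := is_derive_mkAN (is_derive_cstf (0 : R) (0 : R) 1)
    (is_derive_scale (alpha_part p) (is_derive_idf (0 : R) 1))
    (is_derive_mulf (is_derive_idf (0 : R) 1)
      (is_derive_cstf (z_part p) (0 : R) 1)).
  by rewrite (derive_val (is_derive := h)) partsE scale1r.
- apply: (he _ one_param_a); rewrite /s_alg /= derive1E.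
  have h := is_derive_mkAN (is_derive_idf (0 : R) 1)
    (is_derive_cstf (0 : 'rV[R]_D) (0 : R) 1) (is_derive_cstf (0 : R) (0 : R) 1).
  by rewrite (derive_val (is_derive := h)) partsE mem0v.
Qed.

End Subgroup.

(** * Integration of the unit normal geodesics *)

Section NormalGeodesics.
Variables (R : realType) (n : nat).
Local Notation D := (n.-1 + n.-1)%N.
Local Notation pt := 'rV[R]_(1 + (n.-1 + n.-1) + 1).
Variable w : {vspace 'rV[R]_(n.-1 + n.-1)}.
Local Notation W := (alpha_sub w).
Local Notation g := (@gAN R n).

Lemma derive1_is_derive (M : nat) (c dc : R -> 'rV[R]_M) :
  (forall t, is_derive t (1 : R) c (dc t)) -> derive1 c = dc.
Proof.
by move=> h; apply/funext => t; rewrite derive1E (derive_val (is_derive := h t)).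
Qed.

Lemma derivable_is_derive1 (M : nat) (c : R -> 'rV[R]_M) (t : R) :
  derivable c t 1 -> is_derive t (1 : R) c (derive1 c t).
Proof. by move=> h; exact: DeriveDef h (esym (derive1E _ _)). Qed.

Lemma tangent_alpha_sub (p v : pt) : W p ->
  tangent W p v <-> alpha_part v \in w.
Proof.
rewrite /alpha_sub /= => Wp; split.
  move=> [c [c0 nc dc cv]].
  pose P := orthproj (orthv w).
  have hP x : (x \in w) = (P x == 0) by rewrite /P orthproj_eq0 orthvK.
  have h1 := is_derive_lfun P (is_derive_alpha_part (derivable_is_derive1 dc)).
  have h2 : is_derive (0 : R) (1 : R) (fun t => P (alpha_part (c t))) 0.
    have hcst := is_derive_cstf (0 : 'rV[R]_D) (0 : R) 1.
    apply: (near_eq_is_derive _ hcst).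
    near=> t; apply/esym/eqP; rewrite -hP.
    by near: t; exact: nc.
  rewrite hP -cv.
  by rewrite -(derive_val (is_derive := h1)) (derive_val (is_derive := h2)).
move=> hv; exists (fun t => p + t *: v).
have h : forall t, is_derive t (1 : R) (fun t => p + t *: v) v.
  move=> t; have := is_derive_addf (is_derive_cstf p t (1 : R))
    (is_derive_scale v (is_derive_idf t (1 : R))).
  by rewrite add0r scale1r.
split; first by rewrite scale0r addr0.
- near=> t; rewrite /= alpha_partD alpha_partZ rpredD// rpredZ//.
- by case: (h 0).
- by rewrite (derive1_is_derive h).
Unshelve. all: by end_near. Qed.

Lemma normal_alpha_sub (p v : pt) : W p ->
  normal g W p v <->
  [/\ a_part v = 0, alpha_part v \in orthv w & theta p v = 0].
Proof.
move=> Wp; split.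
  move=> h; have hh x : alpha_part x \in w -> g p x v = 0.
    by move=> hx; apply: h; apply/tangent_alpha_sub.
  (* The test vectors are the coordinate directions a and z, then y in [w]; the last test needs the
     first two components to vanish already. *)
  have ha : a_part v = 0.
    have := hh (mkAN 1 0 0); rewrite gANE theta_mk !partsE mem0v => /(_ isT).
    by rewrite !dotE; lra.
  have hz : theta p v = 0.
    have := hh (mkAN 0 0 1); rewrite gANE theta_mk !partsE mem0v => /(_ isT).
    rewrite !dotE !mulr0 mul0r subr0 mul1r !add0r => /eqP.
    by rewrite mulf_eq0 expf_eq0 /= expR_eq0 => /eqP.
  split => //; apply/memv_orthv => y yw.
  have := hh (mkAN 0 y 0); rewrite gANE theta_mk !partsE yw => /(_ isT).
  rewrite hz ha mul0r !mulr0 add0r addr0 => /eqP.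
  by rewrite mulf_eq0 expR_eq0 /= dotC => /eqP.
move=> [ha /memv_orthv hw hz] x /(tangent_alpha_sub _ Wp) hx.
by rewrite gANE ha hz dotC hw// !mulr0 !addr0.
Qed.

Section Solution.
Variable c : R -> pt.
Hypothesis hc : unit_normal_geodesic g W c.

Let a0 := a_part (c 0).
Let v := alpha_part (derive1 c 0).
Let dc := derive1 c.

Let geo t : christoffel g (c t) (dc t) (dc t) = - derive1 dc t.
Proof.
by case: hc => h _ _ _; case: (h t) => _ _ /eqP; rewrite addrC addr_eq0 => /eqP.
Qed.

Let der_c t : is_derive t (1 : R) c (dc t).
Proof. by case: hc => h _ _ _; case: (h t) => /derivable_is_derive1. Qed.

Let der_dc t : is_derive t (1 : R) dc (- christoffel g (c t) (dc t) (dc t)).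
Proof.
by rewrite geo opprK; case: hc => h _ _ _; case: (h t) => _ /derivable_is_derive1.
Qed.

Lemma init_in : alpha_part (c 0) \in w.
Proof. by case: hc. Qed.

Let init_normal : [/\ a_part (dc 0) = 0, v \in orthv w & theta (c 0) (dc 0) = 0].
Proof. by case: hc => _ Wc0 hn _; exact/normal_alpha_sub. Qed.

Lemma init_orth : v \in orthv w.
Proof. by case: init_normal. Qed.

Let der_a t : is_derive t (1 : R) (fun t => a_part (c t)) (a_part (dc t)).
Proof. exact: is_derive_a_part. Qed.

Let der_expRNa t : is_derive t (1 : R) (fun t => expR (- a_part (c t)))
  (- a_part (dc t) * expR (- a_part (c t))).
Proof.
exact: (is_derive_comp1 (is_derive_oppf (der_a t)) (is_derive_expR _)).
Qed.

(* Conservation of the momentum e^(-2a) theta of the central direction. *)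
Lemma geodesic_theta0 t : theta (c t) (dc t) = 0.
Proof.
have hd s : is_derive s (1 : R)
    (fun t => expR (- a_part (c t)) * expR (- a_part (c t)) * theta (c t) (dc t)) 0.
  have h := is_derive_mulf (is_derive_mulf (der_expRNa s) (der_expRNa s))
   (is_derive_subf (is_derive_z_part (der_dc s)) (is_derive_mulcf 2^-1
     (is_derive_dot (is_derive_Jmx (is_derive_alpha_part (der_c s)))
       (is_derive_alpha_part (der_dc s))))).
  apply: (is_derive_eq h); rewrite dotJ_self !partE christoffel_AN !partsE dotNr.
  by rewrite -/(theta (c s) (dc s)); ring.
have /eqP := is_derive_0_is_cst t 0 hd; case: init_normal => _ _ ->; rewrite mulr0.
by rewrite mulf_eq0 -expr2 expf_eq0 expR_eq0 /= => /eqP.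
Qed.

Let der_dU t : is_derive t (1 : R) (fun t => alpha_part (dc t))
  (a_part (dc t) *: alpha_part (dc t)).
Proof.
apply: (is_derive_eq (is_derive_alpha_part (der_dc t))).
rewrite alpha_partN christoffel_AN partsE /christoffel_alpha geodesic_theta0.
by apply/rowP => i; rewrite !mxE; field.
Qed.

Let k t := expR (- a_part (c t)) * dot (alpha_part (dc t)) (alpha_part (dc t)).

Let der_k t : is_derive t (1 : R) k (a_part (dc t) * k t).
Proof.
apply: (is_derive_eq (is_derive_mulf (der_expRNa t)
  (is_derive_dot (der_dU t) (der_dU t)))).
by rewrite !dotE /k; ring.
Qed.

Let der_da t : is_derive t (1 : R) (fun t => a_part (dc t)) (- (2^-1 * k t)).
Proof.
apply: (is_derive_eq (is_derive_a_part (der_dc t))).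
rewrite a_partN christoffel_AN partsE /christoffel_a geodesic_theta0 /k.
by ring.
Qed.

(** Constant speed: the derivative is 2 a' (- k / 2) + a' k = 0. Once theta vanishes, this is the
    whole squared speed. *)
Let energy t : a_part (dc t) ^+ 2 + k t = 1.
Proof.
have hd s : is_derive s (1 : R)
    (fun t => a_part (dc t) * a_part (dc t) + k t) 0.
  apply: (is_derive_eq (is_derive_addf (is_derive_mulf (der_da s) (der_da s))
    (der_k s))); lra.
rewrite expr2 (is_derive_0_is_cst t 0 hd); case: hc => _ _ _.
by rewrite gANE geodesic_theta0 !mulr0 addr0.
Qed.

(* h'' = h / 4; the combinations h + 2 h' and h - 2 h' are exponentials. *)
Let h t := expR (- (a_part (c t) / 2)).

Let der_h t : is_derive t (1 : R) h (- (2^-1 * a_part (dc t)) * h t).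
Proof.
have -> : h = fun t => expR (- (2^-1 * a_part (c t))).
  by apply/funext => s; rewrite /h [_ / 2]mulrC.
exact: (is_derive_comp1 (is_derive_oppf (is_derive_mulcf 2^-1 (der_a t)))
  (is_derive_expR _)).
Qed.

Let hP t : h t * (1 - a_part (dc t)) = h 0 * expR (t / 2).
Proof.
have hd s : is_derive s (1 : R)
    (fun t => h t * (1 - a_part (dc t)) * expR (- (t / 2))) 0.
  apply: (is_derive_eq (is_derive_mulf (is_derive_mulf (der_h s)
    (is_derive_subf (is_derive_cstf (1 : R) s 1) (der_da s)))
    (is_derive_expRN_half s))).
  (* The energy identity removes k from a'' = - k / 2, so that h (1 - a') solves y' = y / 2. *)
  have -> : k s = 1 - a_part (dc s) ^+ 2 by rewrite -(energy s) addrC addKr.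
  by field.
have := is_derive_0_is_cst t 0 hd; case: init_normal => -> _ _.
rewrite mul0r oppr0 expR0 addr0 !mulr1 => <-.
by rewrite -mulrA -expRD addNr expR0 mulr1.
Qed.

Let hQ t : h t * (1 + a_part (dc t)) = h 0 * expR (- (t / 2)).
Proof.
have hd s : is_derive s (1 : R)
    (fun t => h t * (1 + a_part (dc t)) * expR (t / 2)) 0.
  apply: (is_derive_eq (is_derive_mulf (is_derive_mulf (der_h s)
    (is_derive_addf (is_derive_cstf (1 : R) s 1) (der_da s)))
    (is_derive_expR_half s))).
  have -> : k s = 1 - a_part (dc s) ^+ 2 by rewrite -(energy s) addrC addKr.
  by field.
have := is_derive_0_is_cst t 0 hd; case: init_normal => -> _ _.
rewrite mul0r expR0 addr0 !mulr1 => <-.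
by rewrite -mulrA -expRD addrN expR0 mulr1.
Qed.

Let hE t : h t = h 0 * cosh (t / 2).
Proof.
by rewrite /cosh mulrA mulrDr -hP -hQ; field.
Qed.

Let expRNa_sqr t : expR (- a_part (c t)) = h t ^+ 2.
Proof. by rewrite expr2 -expRD; congr expR; lra. Qed.

Lemma geodesic_da t : a_part (dc t) = - tanh (t / 2).
Proof.
have h0 : h 0 != 0 by rewrite expR_eq0.
have e : h t * a_part (dc t) = - (h 0 * sinh (t / 2)).
  by rewrite /sinh mulrA mulrBr -hP -hQ; field.
apply: (mulfI (_ : h t != 0)); first by rewrite expR_eq0.
by rewrite e (hE t) /tanh; field; rewrite cosh_neq0.
Qed.

Lemma geodesic_expRNa t :
  expR (- a_part (c t)) = expR (- a0) * cosh (t / 2) ^+ 2.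
Proof. by rewrite expRNa_sqr hE exprMn -expRNa_sqr. Qed.

(** The vector e^(-a) U' is conserved; the conservation is tested against an arbitrary [y], and
    e^(-a) grows like cosh^2 (t/2). *)
Lemma geodesic_dalpha t : alpha_part (dc t) = (cosh (t / 2) ^+ 2)^-1 *: v.
Proof.
have c0 := cosh_neq0 (t / 2); have e0 : expR (- a0) != 0 by rewrite expR_eq0.
apply: dot_injr => y; apply: (mulfI (_ : expR (- a_part (c t)) != 0)).
  by rewrite expR_eq0.
have aux (E E0 C d : R) : C != 0 -> E = E0 * C -> E0 * d = E * (C^-1 * d).
  by move=> C0 ->; field.
rewrite dotZl; apply: etrans (aux _ _ _ _ (expf_neq0 2 c0) (geodesic_expRNa t)).
have hd s : is_derive s (1 : R)
    (fun t => expR (- a_part (c t)) * dot (alpha_part (dc t)) y) 0.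
  apply: (is_derive_eq (is_derive_mulf (der_expRNa s)
    (is_derive_dot (der_dU s) (is_derive_cstf y s (1 : R))))).
  by rewrite !dotE; ring.
exact: (is_derive_0_is_cst t 0 hd).
Qed.

Lemma geodesic_alpha t :
  alpha_part (c t) = alpha_part (c 0) + (2 * tanh (t / 2)) *: v.
Proof.
have hd s : is_derive s (1 : R)
    (fun t => alpha_part (c t) - (2 * tanh (t / 2)) *: v) 0.
  apply: (is_derive_eq (is_derive_subf (is_derive_alpha_part (der_c s))
    (is_derive_scale v (is_derive_mulcf 2 (is_derive_tanh_half s))))).
  rewrite geodesic_dalpha mulrCA mulfV ?pnatr_eq0// mulr1 subrr.
  by [].
have := rV_cst_of_derive0 hd t 0.
by rewrite mul0r tanh0 mulr0 scale0r subr0 => /eqP; rewrite subr_eq => /eqP.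
Qed.

(** At the foot point the velocity has only a [g_alpha]-component, so unit length reads e^(-a0)
    |v|^2 = 1. *)
Lemma geodesic_speed : dot v v = expR a0.
Proof.
case: hc => _ _ _; rewrite gANE geodesic_theta0 !mulr0 addr0.
case: init_normal => -> _ _; rewrite mul0r add0r => e.
apply: (mulfI (_ : expR (- a0) != 0)); first by rewrite expR_eq0.
by rewrite e -expRD addNr expR0.
Qed.

End Solution.

Section Existence.
Variables (U0 v : 'rV[R]_D) (a0 z0 : R).
Hypotheses (hU0 : U0 \in w) (hv : v \in orthv w) (hvv : dot v v = expR a0).

Let J0 := dot (Jmx U0) v.

(** The z-component is forced by theta = 0: z' = <JU, U'> / 2, and since <Jv, v> = 0 this is <J U0,
    v> sech^2 (t/2) / 2, with primitive tanh (t/2) <J U0, v>. *)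
Definition normal_geodesic (t : R) : pt :=
  mkAN (a0 - 2 * ln (cosh (t / 2))) (U0 + (2 * tanh (t / 2)) *: v)
    (z0 + tanh (t / 2) * J0).

Let der t : is_derive t (1 : R) normal_geodesic
  (mkAN (- tanh (t / 2)) ((cosh (t / 2) ^+ 2)^-1 *: v)
     (2^-1 * (cosh (t / 2) ^+ 2)^-1 * J0)).
Proof.
have ha := is_derive_subf (is_derive_cstf a0 t 1)
  (is_derive_mulcf 2 (is_derive_lncosh_half t)).
have hU := is_derive_addf (is_derive_cstf U0 t 1)
  (is_derive_scale v (is_derive_mulcf 2 (is_derive_tanh_half t))).
have hz := is_derive_addf (is_derive_cstf z0 t 1)
  (is_derive_mulf (is_derive_tanh_half t) (is_derive_cstf J0 t 1)).
apply: (is_derive_eq (is_derive_mkAN ha hU hz)); congr mkAN.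
- by field.
- by rewrite add0r; congr (_ *: _); field; rewrite cosh_neq0.
- by field; rewrite cosh_neq0.
Qed.

Let der2 t : is_derive t (1 : R) (fun t =>
   (mkAN (- tanh (t / 2)) ((cosh (t / 2) ^+ 2)^-1 *: v)
     (2^-1 * (cosh (t / 2) ^+ 2)^-1 * J0) : pt))
  (mkAN (- (2^-1 * (cosh (t / 2) ^+ 2)^-1))
    (- (tanh (t / 2) * (cosh (t / 2) ^+ 2)^-1) *: v)
    (- (2^-1 * tanh (t / 2) * (cosh (t / 2) ^+ 2)^-1 * J0))).
Proof.
have hs : is_derive t (1 : R) (fun t : R => (cosh (t / 2) ^+ 2)^-1)
    (- (tanh (t / 2) * (cosh (t / 2) ^+ 2)^-1)).
  have -> : (fun t : R => (cosh (t / 2) ^+ 2)^-1) =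
      fun t : R => (cosh (t / 2))^-1 * (cosh (t / 2))^-1.
    by apply/funext => s; rewrite expr2 invfM.
  apply: (is_derive_eq (is_derive_mulf (is_derive_sech_half t)
    (is_derive_sech_half t))).
  by rewrite /tanh; field; rewrite cosh_neq0.
have ha := is_derive_oppf (is_derive_tanh_half t).
have hU := is_derive_scale v hs.
have hz := is_derive_mulf (is_derive_mulcf 2^-1 hs) (is_derive_cstf J0 t 1).
apply: (is_derive_eq (is_derive_mkAN ha hU hz)); congr mkAN.
- by field; rewrite cosh_neq0.
- by field; rewrite cosh_neq0.
Qed.

Lemma normal_geodesicP : unit_normal_geodesic g W normal_geodesic.
Proof.
have e1 := derive1_is_derive der; have e2 := derive1_is_derive der2.
have n0 : normal_geodesic 0 = mkAN a0 U0 z0.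
  rewrite /normal_geodesic mul0r tanh0 cosh0 ln1 !mulr0 mul0r scale0r.
  by rewrite subr0 !addr0.
have W0 : W (normal_geodesic 0) by rewrite /alpha_sub /= n0 partsE.
have th t : theta (normal_geodesic t) (derive1 normal_geodesic t) = 0.
  rewrite e1 theta_mk !partsE !JmxE !dotE dotJ_self -/J0; ring.
split => //.
- move=> t; split; first by case: (der t).
    by rewrite e1; case: (der2 t).
  rewrite christoffel_AN /christoffel_a /christoffel_alpha th e1 e2 !partsE.
  have he : expR (- (a0 - 2 * ln (cosh (t / 2)))) =
      expR (- a0) * cosh (t / 2) ^+ 2.
    rewrite opprB expRD mulrC; congr (_ * _).
    by rewrite mulrC mulr_natr mulr2n expRD lnK ?expr2// posrE cosh_gt0.
  have hee : expR (- a0) * expR a0 = 1 by rewrite -expRD addNr expR0.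
  apply: AN_ext; rewrite !partE ?he.
  + rewrite !dotE hvv.
    have -> : forall x y z t' : R, x * y * (z * (z * t')) = (x * t') * y * z * z.
      by move=> *; ring.
    by rewrite hee; field; rewrite cosh_neq0.
  + apply/rowP => i; rewrite !mxE; field; rewrite cosh_neq0; ring.
  + rewrite !JmxE !dotE dotJ_self -/J0; field; rewrite cosh_neq0; ring.
- apply/(normal_alpha_sub _ W0); rewrite th e1 !partsE mul0r tanh0 oppr0.
  by split => //; rewrite rpredZ.
- rewrite gANE th e1 n0 !partsE !dotE mul0r tanh0 cosh0 hvv expr1n invr1.
  by rewrite oppr0 !mulr0 !mul1r add0r addr0 -expRD addNr expR0.
Qed.

End Existence.
End NormalGeodesics.

(** * The tube as a level set *)

Section Tube.
Variables (R : realType) (n : nat).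
Local Notation D := (n.-1 + n.-1)%N.
Local Notation pt := 'rV[R]_(1 + (n.-1 + n.-1) + 1).
Variable w : {vspace 'rV[R]_(n.-1 + n.-1)}.
Variable r : R.
Hypothesis r_gt0 : 0 < r.
Local Notation W := (alpha_sub w).
Local Notation g := (@gAN R n).
Local Notation P := (orthproj (orthv w)).

Let T := tanh (r / 2).
(** This is 1 / sinh r, the difference of coth (r/2) / 2 and tanh (r/2) / 2. It rescales [zeta] to
    the U-component of the geodesic velocity at time r. *)
Let kappa := (2 * sinh (r / 2) * cosh (r / 2))^-1.

Definition zeta (p : pt) := P (alpha_part p).

Definition tube_level : set pt :=
  [set p | dot (zeta p) (zeta p) = 4 * sinh (r / 2) ^+ 2 * expR (a_part p)].

Let c0 : cosh (r / 2) != 0. Proof. exact: cosh_neq0. Qed.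
Let s_gt0 : 0 < sinh (r / 2). Proof. by rewrite sinh_gt0// divr_gt0. Qed.
Let s0 : sinh (r / 2) != 0. Proof. exact: lt0r_neq0. Qed.
Let T0 : T != 0. Proof. by rewrite /T /tanh mulf_neq0// invr_eq0. Qed.

Lemma orthproj_orthv_eq0 x : x \in w -> P x = 0.
Proof. by move=> h; apply/eqP; rewrite orthproj_eq0 orthvK. Qed.

Lemma zeta_orthv p : zeta p \in orthv w.
Proof. exact: memv_orthproj. Qed.

Lemma zeta_geodesic c : unit_normal_geodesic g W c ->
  zeta (c r) = (2 * T) *: alpha_part (derive1 c 0).
Proof.
move=> hc; rewrite /zeta (geodesic_alpha hc r) orthprojD orthprojZ.
by rewrite (orthproj_orthv_eq0 (init_in hc)) add0r orthproj_id// (init_orth hc).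
Qed.

Lemma tubeE : tube g W r = tube_level.
Proof.
apply/seteqP; split => p; rewrite /tube_level /=.
  move=> [c hc <-]; rewrite (zeta_geodesic hc) !dotE (geodesic_speed hc).
  have := geodesic_expRNa hc r; rewrite !expRN => e.
  have e0 := expR_eq0 (a_part (c 0)); have e1 := expR_eq0 (a_part (c r)).
  have -> : expR (a_part (c 0)) = expR (a_part (c r)) * cosh (r / 2) ^+ 2.
    by rewrite -[LHS]invrK -[X in X * _]invrK e; field; rewrite c0 e0.
  by rewrite /T /tanh; field.
move=> hp.
(* The geodesic formulas at time r are solved for the initial data: U splits into its w-component
   [U0] and 2 T v, while a0 and z0 undo the shifts in a and z. *)
pose v := (2 * T)^-1 *: zeta p; pose U0 := alpha_part p - zeta p.
pose a0 := a_part p + 2 * ln (cosh (r / 2)).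
have hU0 : U0 \in w.
  by have := sub_orthproj (orthv w) (alpha_part p); rewrite orthvK.
have hv : v \in orthv w by rewrite rpredZ// zeta_orthv.
have hvv : dot v v = expR a0.
  rewrite /v !dotE hp /a0 expRD [2 * ln _]mulrC mulr_natr mulr2n expRD.
  rewrite lnK ?posrE ?cosh_gt0// /T /tanh; field.
  by rewrite c0 s0.
exists (normal_geodesic U0 v a0 (z_part p - T * dot (Jmx U0) v)).
  exact: normal_geodesicP.
apply: AN_ext; rewrite /normal_geodesic !partsE -/T.
- by rewrite /a0 addrK.
- by rewrite /U0 /v scalerA mulfV ?scale1r ?subrK// mulf_neq0// pnatr_eq0.
- by rewrite subrK.
Qed.

Lemma zeta_neq0 p : tube_level p -> zeta p != 0.
Proof.
rewrite /tube_level /= => h; apply/eqP => z0.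
have : 0 < 4 * sinh (r / 2) ^+ 2 * expR (a_part p).
  by rewrite mulr_gt0 ?expR_gt0// mulr_gt0// exprn_gt0.
by rewrite -h z0 dot0l ltxx.
Qed.

(* A polynomial extension of the inward unit normal, which in the
   left-invariant frame is tanh (r/2) B - sech (r/2) xi. *)
Definition eta (p : pt) : pt :=
  mkAN T (- kappa *: zeta p)
    (- (2^-1 * kappa) * dot (Jmx (alpha_part p)) (zeta p)).

Lemma theta_eta p : theta p (eta p) = 0.
Proof. by rewrite theta_mk !dotE; ring. Qed.

Lemma eta_points_towards : points_towards g W r eta.
Proof.
move=> c hc; have e := geodesic_theta0 hc r; move: (e).
rewrite /theta => /eqP; rewrite subr_eq0 => /eqP hz.
have ha := geodesic_da hc r; have hU := geodesic_dalpha hc r.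
have hk : kappa * (2 * T) = (cosh (r / 2) ^+ 2)^-1.
  by rewrite /kappa /T /tanh; field; rewrite c0 s0.
apply: AN_ext; rewrite /eta !partE ?(zeta_geodesic hc).
- by rewrite ha opprK.
- by rewrite hU scalerA mulNr hk scaleNr.
- rewrite hz hU !dotE -hk; ring.
Qed.

(** [unit_normal_field] asks for full differentiability, which directional derivatives alone do not
    give. The field is a constant plus a linear map plus one quadratic term. *)
Lemma differentiable_eta p : differentiable eta p.
Proof.
have -> : eta = fun q => mkAN T 0 0 + (alpha_inj (- kappa *: zeta q)
     + (- (2^-1 * kappa) * dot (Jmx (alpha_part q)) (zeta q)) *: (mkAN 0 0 1 : pt)).
  apply/funext => q; apply: AN_ext; rewrite /eta /alpha_inj !partE;
    by rewrite ?mulr0 ?mulr1 ?scaler0 ?addr0 ?add0r.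
have dalpha : differentiable (fun q : pt => alpha_part q) p.
  exact: (@differentiable_linear_rV _ _ _ (@alpha_part R n)).
have dzeta : differentiable zeta p.
  apply: (differentiable_comp dalpha).
  apply: differentiable_linear_rV.
have dJ : differentiable (fun q : pt => Jmx (alpha_part q)) p.
  apply: (differentiable_comp dalpha).
  exact: (@differentiable_linear_rV _ _ _ (@Jmx R n.-1)).
apply: differentiableD; first exact: differentiable_cst.
apply: differentiableD.
  apply: (@differentiable_comp _ _ _ _
    (fun q => - kappa *: zeta q) (@alpha_inj R n)).
    exact: differentiableZ.
  exact: (@differentiable_linear_rV _ _ _ (@alpha_inj R n)).
apply: differentiableZl.
apply: (@differentiableZ _ _ _ (fun q : pt => dot (Jmx (alpha_part q)) (zeta q))).
have -> : (fun q => dot (Jmx (alpha_part q)) (zeta q)) =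
    \sum_i ((fun q => Jmx (alpha_part q) 0 i) * (fun q => zeta q 0 i)).
  by apply/funext => q; rewrite dot_sum fct_sumE.
apply: differentiable_sum => i; apply: differentiableM.
  exact: (differentiable_comp dJ (differentiable_coord _ 0 i)).
exact: (differentiable_comp dzeta (differentiable_coord _ 0 i)).
Qed.

Lemma is_derive_zeta (V : normedModType R) (c : V -> pt) (x v : V) dc :
  is_derive x v c dc -> is_derive x v (fun t => zeta (c t)) (zeta dc).
Proof. by move=> h; exact: (is_derive_lfun P (is_derive_alpha_part h)). Qed.

Lemma tangent_tube p v : tube_level p ->
  tangent tube_level p v <->
  dot (zeta p) (alpha_part v) = 2 * sinh (r / 2) ^+ 2 * expR (a_part p) * a_part v.
Proof.
move=> Mp; split.
  move=> [c [cp nc dc cv]].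
  have hd := derivable_is_derive1 dc; rewrite cv in hd.
  have h1 := is_derive_subf (is_derive_dot (is_derive_zeta hd) (is_derive_zeta hd))
    (is_derive_mulcf (4 * sinh (r / 2) ^+ 2)
      (is_derive_comp1 (is_derive_a_part hd) (is_derive_expR _))).
  have hcst := is_derive_cstf (0 : R) (0 : R) 1.
  have h2 : is_derive (0 : R) (1 : R) (fun t => dot (zeta (c t)) (zeta (c t)) -
    4 * sinh (r / 2) ^+ 2 * expR (a_part (c t))) 0.
    apply: (near_eq_is_derive _ hcst); near=> t; apply/esym/eqP.
    by rewrite subr_eq0; apply/eqP; near: t; exact: nc.
  have := derive_val (is_derive := h1); rewrite (derive_val (is_derive := h2)) cp.
  rewrite (dotC (zeta v)) /zeta -dot_orthproj; lra.
move=> h.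
(* The curve moves U and z linearly and lets the level equation determine a; [A] is that
   solution. *)
pose A (t : R) := ln (dot (zeta p + t *: zeta v) (zeta p + t *: zeta v)
   / (4 * sinh (r / 2) ^+ 2)).
have s4 : 0 < 4 * sinh (r / 2) ^+ 2 by rewrite mulr_gt0// exprn_gt0.
have A0 : A 0 = a_part p.
  by rewrite /A scale0r addr0 Mp mulrAC mulfV ?lt0r_neq0// mul1r expRK.
pose c t : pt := mkAN (A t) (alpha_part p + t *: alpha_part v)
  (z_part p + t * z_part v).
have zc t : zeta (c t) = zeta p + t *: zeta v.
  by rewrite /zeta partsE orthprojD orthprojZ.
have hl : is_derive (0 : R) (1 : R) (fun t => zeta p + t *: zeta v) (zeta v).
  apply: (is_derive_eq (is_derive_addf (is_derive_cstf (zeta p) (0 : R) 1)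
    (is_derive_scale (zeta v) (is_derive_idf (0 : R) 1)))).
  by rewrite add0r scale1r.
have hA : is_derive (0 : R) (1 : R) A (a_part v).
  have hq := is_derive_mulf (is_derive_dot hl hl)
    (is_derive_cstf (4 * sinh (r / 2) ^+ 2)^-1 (0 : R) 1).
  have hpos : 0 < dot (zeta p + (0 : R) *: zeta v) (zeta p + (0 : R) *: zeta v)
    / (4 * sinh (r / 2) ^+ 2).
    by rewrite scale0r addr0 divr_gt0// dot_gt0// zeta_neq0.
  apply: (is_derive_eq (is_derive_comp1 hq (is_derive1_ln hpos))).
  rewrite scale0r addr0 Mp (dotC (zeta v)) {1 2}/zeta -dot_orthproj h.
  field.
  by rewrite expR_eq0 s0.
have hc : is_derive (0 : R) (1 : R) c v.
  apply: (is_derive_eq (is_derive_mkAN hA (is_derive_addf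
     (is_derive_cstf (alpha_part p) (0 : R) 1)
     (is_derive_scale (alpha_part v) (is_derive_idf (0 : R) 1)))
    (is_derive_addf (is_derive_cstf (z_part p) (0 : R) 1)
     (is_derive_mulf (is_derive_idf (0 : R) 1)
      (is_derive_cstf (z_part v) (0 : R) 1))))).
  by rewrite !add0r scale1r mul1r mul0r addr0 mkAN_parts.
exists c; split.
- by apply: AN_ext; rewrite !partsE ?A0 ?scale0r ?mul0r ?addr0.
(* [ln] inverts [expR] only on positive reals; by continuity the moving [zeta] stays nonzero near
   time 0. *)
- have pos : \forall t \near (0 : R), 0 <
     dot (zeta p + t *: zeta v) (zeta p + t *: zeta v).
    have h2 := is_derive_dot hl hl.
    have : {for (0 : R), continuous (fun t : R =>
        dot (zeta p + t *: zeta v) (zeta p + t *: zeta v))}.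
      apply: differentiable_continuous; apply/derivable1_diffP.
      by case: h2.
    move=> /cvgr_gt; apply.
    by rewrite scale0r addr0 dot_gt0// zeta_neq0.
  near=> t; rewrite /tube_level /= zc partsE /A lnK.
    by rewrite mulrC divfK// lt0r_neq0.
  by rewrite posrE divr_gt0//; near: t.
- by case: hc.
- by rewrite derive1E (derive_val (is_derive := hc)).
Unshelve. all: by end_near. Qed.

Lemma eta_unit_normal_field : unit_normal_field g tube_level eta.
Proof.
move=> p Mp; have e0 : expR (- a_part p) * expR (a_part p) = 1.
  by rewrite -expRD addNr expR0.
split; first exact: differentiable_eta.
- move=> x /(tangent_tube _ Mp) hx.
  rewrite gANE theta_eta /eta !partsE !dotE dotC hx.
  have -> : expR (- a_part p) * (- kappa *
      (2 * sinh (r / 2) ^+ 2 * expR (a_part p) * a_part x)) =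
      (expR (- a_part p) * expR (a_part p)) *
      (- kappa * (2 * sinh (r / 2) ^+ 2 * a_part x)) by ring.
  rewrite e0 /kappa /T /tanh; field.
  by rewrite c0 s0.
- rewrite gANE theta_eta /eta !partsE !dotE Mp.
  have -> : expR (- a_part p) * (- kappa * (- kappa *
      (4 * sinh (r / 2) ^+ 2 * expR (a_part p)))) =
      (expR (- a_part p) * expR (a_part p)) *
      (kappa ^+ 2 * (4 * sinh (r / 2) ^+ 2)) by ring.
  rewrite e0 mul0r mulr0 addr0 mul1r /kappa /T /tanh.
  (* The claim is tanh^2 + sech^2 = 1; [field] does not know this relation, so sinh^2 = cosh^2 - 1
     is put into the tanh^2 term beforehand. *)
  have -> : sinh (r / 2) / cosh (r / 2) * (sinh (r / 2) / cosh (r / 2)) =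
    (cosh (r / 2) ^+ 2 - 1) / cosh (r / 2) ^+ 2.
    by rewrite -[X in _ - X](cosh2B_sinh2 (r / 2)); field.
  by field; rewrite c0 s0.
Qed.

Lemma derive_eta p X : 'D_X eta p = mkAN 0 (- kappa *: zeta X)
  (- (2^-1 * kappa) * (dot (Jmx (alpha_part X)) (zeta p)
    + dot (Jmx (alpha_part p)) (zeta X))).
Proof.
have hid := is_derive_idf p X.
have h := is_derive_mkAN (is_derive_cstf T p X)
  (is_deriveZ (- kappa) (is_derive_zeta hid))
  (is_derive_mulcf (- (2^-1 * kappa)) (is_derive_dot
    (is_derive_Jmx (is_derive_alpha_part hid)) (is_derive_zeta hid))).
exact: (derive_val (is_derive := h)).
Qed.

Lemma nabla_eta_a p X : a_part (nabla g X eta p) =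
  - (2^-1 * kappa * expR (- a_part p) * dot (alpha_part X) (zeta p)).
Proof.
rewrite /nabla derive_eta christoffel_AN /christoffel_a theta_eta /eta !partE !dotE.
by ring.
Qed.

Lemma nabla_eta_alpha p X : alpha_part (nabla g X eta p) =
  - kappa *: zeta X + (2^-1 * kappa * a_part X) *: zeta p
  - (2^-1 * T) *: alpha_part X
  + (2^-1 * kappa * expR (- a_part p) * theta p X) *: Jmx (zeta p).
Proof.
rewrite /nabla derive_eta christoffel_AN /christoffel_alpha theta_eta /eta.
rewrite !partE !JmxE; apply/rowP => i; rewrite !mxE; ring.
Qed.

(** Measured by theta instead of dz, the term <J U, zeta X> of the derivative of [eta], where U is
    the position, cancels. *)
Lemma nabla_eta_theta p X : theta p (nabla g X eta p) =
  - (2^-1 * kappa * dot (Jmx (alpha_part X)) (zeta p)) - T * theta p X.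
Proof.
rewrite /nabla derive_eta christoffel_AN thetaDr theta_eta !theta_mk.
rewrite /eta !partE !dotE; ring.
Qed.

(** Since [eta] has unit length along the tube, its derivative is already tangent; the pairing with
    [eta] is evaluated from the explicit components and the tangency equation. *)
Lemma shape_operator_tube p X : tube_level p -> tangent tube_level p X ->
  shape_operator g eta p X = - nabla g X eta p.
Proof.
move=> Mp /(tangent_tube _ Mp) hX; rewrite /shape_operator.
have -> : g p (nabla g X eta p) (eta p) = 0; last by rewrite scale0r subr0.
rewrite gANE theta_eta nabla_eta_a nabla_eta_alpha /eta !partsE !dotE.
rewrite (dotC (alpha_part X)) hX (dotC (zeta X)) {1 3}/zeta -dot_orthproj hX.
rewrite dotJ_self Mp /kappa /T /tanh.
field.
by rewrite c0 s0.
Qed.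

End Tube.

Lemma dim_hyperplane_AN (n d : nat) : (0 < n)%N ->
  (1 + d = 1 + (n.-1 + n.-1) + 1)%N -> d = (2 * n - 1)%N.
Proof. lia. Qed.

(** * Curvature spaces *)

Section PrincipalCurvatures.
Variables (R : realType) (n : nat).
Local Notation D := (n.-1 + n.-1)%N.
Local Notation pt := 'rV[R]_(1 + (n.-1 + n.-1) + 1).
Variables (w : {vspace 'rV[R]_(n.-1 + n.-1)}) (r phi : R).
Hypothesis r_gt0 : 0 < r.
Local Notation P := (orthproj (orthv w)).
Hypotheses (sin_neq0 : sin phi != 0) (cos_neq0 : cos phi != 0).
Local Notation g := (@gAN R n).
Local Notation M := (tube_level w r).
Local Notation eta := (eta w r).
Local Notation zeta := (zeta w).

Variable p : pt.
Hypothesis Mp : M p.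
Variables F Q : 'rV[R]_D.
Hypotheses (F_in : F \in orthv w) (Q_in : Q \in w).
(* F and Q play the roles of F xi and P xi, scaled by |zeta p|. *)
Hypothesis JzE : Jmx (zeta p) = F + Q.
Hypothesis FF : dot F F = cos phi ^+ 2 * dot (zeta p) (zeta p).

Let s := sinh (r / 2).
Let c := cosh (r / 2).
Let T := tanh (r / 2).
Let kappa := (2 * s * c)^-1.
Let E := expR (- a_part p).
Let Z2 := dot (zeta p) (zeta p).

Let c_neq0 : c != 0. Proof. exact: cosh_neq0. Qed.
Let s_neq0 : s != 0. Proof. by rewrite lt0r_neq0// sinh_gt0// divr_gt0. Qed.
Let E_neq0 : E != 0. Proof. by rewrite expR_eq0. Qed.
Let kappa_neq0 : kappa != 0.
Proof. by rewrite invr_eq0 mulf_neq0// mulf_neq0. Qed.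
Let k2_neq0 : 2^-1 * kappa != 0.
Proof. by rewrite mulf_neq0// invr_eq0 pnatr_eq0. Qed.
Let c1_neq0 : 2^-1 * kappa * E != 0. Proof. exact: mulf_neq0. Qed.
Let Z2_neq0 : Z2 != 0.
Proof. by rewrite lt0r_neq0// dot_gt0// (zeta_neq0 r_gt0 Mp). Qed.
Let TE : T = s / c. Proof. by []. Qed.
Let c2s2 : c ^+ 2 - s ^+ 2 = 1. Proof. exact: cosh2B_sinh2. Qed.
Let Z2E : Z2 = 4 * s ^+ 2 * E^-1.
Proof. by rewrite /E expRN invrK. Qed.

Let zetaP : P (zeta p) = zeta p.
Proof. by rewrite orthproj_id// zeta_orthv. Qed.
Let dot_w x y : x \in w -> y \in orthv w -> dot x y = 0.
Proof. by move=> xw /memv_orthv h; rewrite dotC h. Qed.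
Let QF : dot Q F = 0. Proof. exact: dot_w. Qed.
Let QQ : dot Q Q = sin phi ^+ 2 * Z2.
Proof.
have h1 := dotJJ (zeta p) (zeta p); have h2 := cos2Dsin2 phi.
rewrite JzE !dotE (dotC F Q) QF FF in h1.
have -> : sin phi ^+ 2 = 1 - cos phi ^+ 2 by lra.
rewrite -/Z2 in h1; lra.
Qed.
Let PF : P F = F. Proof. by rewrite orthproj_id. Qed.
Let PQ : P Q = 0. Proof. exact: orthproj_orthv_eq0. Qed.
Let zF : dot (zeta p) F = 0.
Proof.
have := dotJ_self (zeta p).
by rewrite JzE dotDl (dot_w Q_in) ?zeta_orthv// addr0 dotC.
Qed.
Let F_neq0 : F != 0.
Proof.
apply/eqP => h; move: FF; rewrite h dot0l => /esym/eqP.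
by apply/negP; rewrite mulf_neq0// expf_neq0.
Qed.
Let Q_neq0 : Q != 0.
Proof.
apply/eqP => h; move: QQ; rewrite h dot0l => /esym/eqP.
by apply/negP; rewrite mulf_neq0// expf_neq0.
Qed.

(** Tangency leaves V and y = theta free and fixes the a-component. On the tube 2 sinh^2 (r/2) e^a
    is half of |zeta|^2, hence the factor 2 / Z2. *)
Definition tangent_of (V : 'rV[R]_D) (y : R) : pt :=
  mkAN (2 * dot (zeta p) V / Z2) V (y + 2^-1 * dot (Jmx (alpha_part p)) V).

Lemma theta_tangent_of V y : theta p (tangent_of V y) = y.
Proof. by rewrite theta_mk addrK. Qed.

Lemma tangent_ofP X : tangent M p X <-> X = tangent_of (alpha_part X) (theta p X).
Proof.
rewrite (tangent_tube r_gt0 _ Mp).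
have e : 2 * sinh (r / 2) ^+ 2 * expR (a_part p) = Z2 / 2 by rewrite /Z2 Mp; field.
rewrite e; split => [h|->].
  apply: AN_ext; rewrite !partsE ?h.
  - by field.
  - by [].
  - by rewrite /theta subrK.
by rewrite !partsE; field.
Qed.

(* The equation [shape_operator X = l *: X] in the coordinates (V, y) of
   [X = tangent_of V y]; its a-component is redundant. *)
Definition eigen_eq l (V : 'rV[R]_D) (y : R) : Prop :=
  kappa *: (P V - (dot (zeta p) V / Z2) *: zeta p) + (2^-1 * T - l) *: V =
    (2^-1 * kappa * E * y) *: Jmx (zeta p)
  /\ - (2^-1 * kappa * dot V (Jmx (zeta p))) + (T - l) * y = 0.

Lemma AN_ext_theta (x y : pt) : a_part x = a_part y ->
  alpha_part x = alpha_part y -> theta p x = theta p y -> x = y.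
Proof.
by move=> ha hU; rewrite /theta hU => /addIr; exact: AN_ext.
Qed.

Lemma subr_eq_iff (V : zmodType) (x y x' y' : V) :
  x - y = x' - y' -> (x = y <-> x' = y').
Proof.
by move=> h; split=> e; apply/subr0_eq; [rewrite -h e subrr | rewrite h e subrr].
Qed.

Lemma curvature_spaceE l X : curvature_space g M eta p l X <->
  X = tangent_of (alpha_part X) (theta p X)
  /\ eigen_eq l (alpha_part X) (theta p X).
Proof.
set V := alpha_part X; set y := theta p X.
have hX : X = tangent_of V y -> [/\ a_part X = 2 * dot (zeta p) V / Z2,
   alpha_part (shape_operator g eta p X) = kappa *: P V
     - (kappa * (dot (zeta p) V / Z2)) *: zeta p + (2^-1 * T) *: V
     - (2^-1 * kappa * E * y) *: Jmx (zeta p),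
   theta p (shape_operator g eta p X) =
     - (2^-1 * kappa * dot V (Jmx (zeta p))) + T * y
   & a_part (shape_operator g eta p X) = 2^-1 * kappa * E * dot (zeta p) V].
  move=> hX; have tX : tangent M p X by apply/tangent_ofP.
  have aX : a_part X = 2 * dot (zeta p) V / Z2 by rewrite hX partsE.
  rewrite (shape_operator_tube r_gt0 Mp tX); split => //.
  - rewrite alpha_partN nabla_eta_alpha aX -/V -/y -/T -/kappa -/E.
    by apply/rowP => i; rewrite !mxE; field.
  - rewrite -(scaleN1r (nabla _ _ _ _)) thetaZr nabla_eta_theta.
    by rewrite dotJl -/V -/y -/T -/kappa; ring.
  - by rewrite a_partN nabla_eta_a dotC opprK.
rewrite /curvature_space /=; split.
  move=> [/tangent_ofP /[dup] h /hX[ha hal hth hsa] hS]; split => //; split.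
  - apply/(subr_eq_iff (_ : _ = alpha_part (shape_operator g eta p X) - l *: V)).
      by rewrite hal; apply/rowP => i; rewrite !mxE; ring.
    by rewrite hS alpha_partZ.
  - by have := congr1 (theta p) hS; rewrite hth thetaZr -/y; lra.
move=> [h [h1 h2]]; split; first exact/tangent_ofP.
have [ha hal hth hsa] := hX h.
have hV : alpha_part (shape_operator g eta p X) = l *: V.
  apply/(subr_eq_iff (_ : _ = kappa *: (P V - (dot (zeta p) V / Z2) *: zeta p)
    + (2^-1 * T - l) *: V - (2^-1 * kappa * E * y) *: Jmx (zeta p))) => //.
  by rewrite hal; apply/rowP => i; rewrite !mxE; ring.
(* Pairing the U-equation with zeta gives this; together with [hZ] it is the a-component of the
   eigenvalue equation. *)
have hl : (2^-1 * T - l) * dot (zeta p) V = 0.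
  have := congr1 (dot (zeta p)) h1; rewrite !dotE (dotC _ (Jmx _)) dotJ_self.
  rewrite -dot_orthprojC zetaP -/Z2 mulr0 => <-.
  by field.
have hZ : 2^-1 * kappa * E * Z2 = T.
  by rewrite Z2E /kappa TE; field; rewrite E_neq0 s_neq0 c_neq0.
apply: AN_ext_theta.
- rewrite hsa a_partZ ha; apply: (mulIf Z2_neq0).
  have -> : l * (2 * dot (zeta p) V / Z2) * Z2 = T * dot (zeta p) V.
    rewrite mulrA mulfVK//; lra.
  by rewrite -hZ; field.
- by rewrite hV alpha_partZ.
- by rewrite hth thetaZr -/y; lra.
Qed.

(** J zeta has the components F and Q in the complement of [w] and in [w], so projecting decouples
    the vector equation. *)
Lemma eigen_eq_proj l V y : eigen_eq l V y ->
  kappa *: (P V - (dot (zeta p) V / Z2) *: zeta p) + (2^-1 * T - l) *: P V =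
    (2^-1 * kappa * E * y) *: F
  /\ (2^-1 * T - l) *: (V - P V) = (2^-1 * kappa * E * y) *: Q.
Proof.
move=> [h1 _]; have h := congr1 P h1.
have PP : P (P V) = P V by rewrite orthproj_id// memv_orthproj.
have h2 : kappa *: (P V - (dot (zeta p) V / Z2) *: zeta p) + (2^-1 * T - l) *: P V =
    (2^-1 * kappa * E * y) *: F.
  rewrite JzE in h; move: h.
  rewrite -scaleNr !(orthprojD, orthprojZ) PP zetaP PF PQ addr0.
  by rewrite scaleNr.
split=> //.
have := congr1 (fun x => x - (2^-1 * kappa * E * y) *: F) h1.
rewrite /= -{1}h2 JzE => e.
rewrite -[RHS](addrK ((2^-1 * kappa * E * y) *: F)) -scalerDr (addrC Q) -e.
by apply/rowP => i; rewrite !mxE; ring.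
Qed.

Let tau := 2^-1 * T.
Let chi := 2^-1 * (c / s).
(** coth - tanh = 1 / (sinh cosh), by cosh^2 - sinh^2 = 1. Thus kappa + tau is the coefficient on
    normal directions orthogonal to zeta. *)
Let chiE : chi = kappa + tau.
Proof.
rewrite /chi /kappa /tau TE; apply/eqP; rewrite -subr_eq0.
have -> : 2^-1 * (c / s) - ((2 * s * c)^-1 + 2^-1 * (s / c)) =
   2^-1 * (c ^+ 2 - s ^+ 2 - 1) / (s * c) by field; rewrite s_neq0 c_neq0.
by rewrite c2s2 subrr mulr0 mul0r.
Qed.

Let tanh_tau : tanh (r / 2) / 2 = tau. Proof. exact: mulrC. Qed.
Let coth_chi : coth (r / 2) / 2 = chi. Proof. exact: mulrC. Qed.

(* Up to sign, the characteristic polynomial of the shape operator on the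
   invariant 3-space of the [tangent_of V y] with V in the span of F and Q. *)
Definition char_cubic l : R := (T - l) * (chi - l) * (tau - l)
  - (2 * c)^-1 ^+ 2 * (cos phi ^+ 2 * (tau - l) + sin phi ^+ 2 * (chi - l)).

(** The solution V for y = 1: the vector equation multiplies the F-component by chi - l and the
    Q-component by tau - l, and both can be divided out. *)
Let Vl l : 'rV[R]_D :=
  (2^-1 * kappa * E) *: ((chi - l)^-1 *: F + (tau - l)^-1 *: Q).

Let PVl l : P (Vl l) = (2^-1 * kappa * E / (chi - l)) *: F.
Proof.
rewrite /Vl orthprojZ orthprojD !orthprojZ PF PQ.
by apply/rowP => i; rewrite !mxE; ring.
Qed.

Let zVl l : dot (zeta p) (Vl l) = 0.
Proof. by rewrite -zetaP dot_orthprojC PVl dotZr zF mulr0. Qed.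

(** The base point drops out here: by the level equation (kappa / 2)^2 E Z2 = kappa^2 sinh^2 (r/2) =
    1 / (4 cosh^2 (r/2)). *)
Let VlJ l : chi - l != 0 -> tau - l != 0 ->
  2^-1 * kappa * dot (Vl l) (Jmx (zeta p)) =
  (2 * c)^-1 ^+ 2 * (cos phi ^+ 2 / (chi - l) + sin phi ^+ 2 / (tau - l)).
Proof.
move=> h1 h2; rewrite JzE /Vl !dotE (dotC F Q) QF FF QQ -/Z2 Z2E /kappa.
by field; rewrite E_neq0 s_neq0 c_neq0 h1 h2.
Qed.

Lemma eigen_eq_generic l V y : l != tau -> l != chi ->
  eigen_eq l V y <-> V = y *: Vl l /\ y * char_cubic l = 0.
Proof.
move=> htau' hchi'.
have htau : tau - l != 0 by rewrite subr_eq0 eq_sym.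
have hchi : chi - l != 0 by rewrite subr_eq0 eq_sym.
(* [char_cubic] is the scalar equation at V = [Vl l], y = 1, cleared of the denominators chi - l and
   tau - l. *)
have hq : (T - l - 2^-1 * kappa * dot (Vl l) (Jmx (zeta p))) *
  ((chi - l) * (tau - l)) = char_cubic l.
  by rewrite VlJ// /char_cubic; field; rewrite htau hchi c_neq0.
split.
  move=> /[dup] [[h1 h2]] /eigen_eq_proj [h3 h4].
  have hz : dot (zeta p) V = 0.
    have := congr1 (dot (zeta p)) h3.
    rewrite !dotE zF mulr0 -dot_orthprojC zetaP -/Z2 divfK// subrr mulr0 add0r.
    by move/eqP; rewrite mulf_eq0 (negbTE htau) => /eqP.
  have hP : P V = (2^-1 * kappa * E * y / (chi - l)) *: F.
    apply: (scalerI hchi); rewrite scalerA mulrC divfK// -h3 hz mul0r scale0r subr0.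
    by rewrite -scalerDl; congr (_ *: _); rewrite chiE /tau; ring.
  have hV : V = y *: Vl l.
    rewrite -(subrK (P V) V).
    have -> : V - P V = (2^-1 * kappa * E * y / (tau - l)) *: Q.
      by apply: (scalerI htau); rewrite scalerA mulrC divfK// -h4.
    by rewrite hP; apply/rowP => i; rewrite !mxE; ring.
  split => //; rewrite -hq mulrA; apply/eqP; rewrite mulf_eq0; apply/orP; left.
  by apply/eqP; rewrite -[RHS]h2 hV dotZl; ring.
move=> [-> hy]; split.
  rewrite dotZr zVl mulr0 mul0r scale0r subr0 orthprojZ PVl JzE.
  rewrite chiE -/tau in hchi *.
  by apply/rowP => i; rewrite !mxE chiE; field; rewrite hchi htau.
move/eqP: hy; rewrite -hq mulrA mulf_eq0 [X in _ || X]mulf_eq0.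
rewrite (negbTE hchi) (negbTE htau) !orbF.
by move/eqP => e; rewrite -[RHS]e dotZl; ring.
Qed.

(** At this value the w-part of the equation makes y Q vanish, so y = 0 because sin phi is nonzero.
    Then P V is a multiple of zeta, and the scalar equation removes the direction Q. *)
Lemma eigen_eq_tau V y : eigen_eq tau V y <->
  y = 0 /\ V \in ((w + <[zeta p]>) :&: orthv <[Q]>)%VS.
Proof.
have dF x : x \in (w + <[zeta p]>)%VS -> dot x F = 0.
  move=> /memv_addP[b bw [_ /vlineP[d ->] ->]].
  by rewrite dotDl dotZl zF (dot_w bw F_in) mulr0 addr0.
split.
  move=> /[dup] [[h1 h2]] /eigen_eq_proj [].
  rewrite -/tau subrr !scale0r addr0 => h3 /esym/eqP.
  rewrite scaler_eq0 (negbTE Q_neq0) orbF mulf_eq0.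
  rewrite (negbTE c1_neq0) /= => /eqP y0.
  split => //; move: h3 h2; rewrite y0 !mulr0 scale0r addr0 => /eqP.
  rewrite scaler_eq0 (negbTE kappa_neq0) subr_eq0 /= => /eqP hP /eqP.
  have hV : V \in (w + <[zeta p]>)%VS.
    rewrite -(subrK (P V) V); apply: memv_add.
      by have := sub_orthproj (orthv w) V; rewrite orthvK.
    by rewrite hP rpredZ// memv_line.
  rewrite oppr_eq0 mulf_eq0 (negbTE k2_neq0) /= JzE dotDr dF// add0r.
  by rewrite memv_cap hV memv_orth_line.
move=> [-> ]; rewrite memv_cap memv_orth_line => /andP[/[dup] hV /dF hF /eqP hQ].
split; last by rewrite JzE dotDr hF hQ; ring.
rewrite -/tau subrr scale0r mulr0 scale0r addr0.
move: hV => /memv_addP[b bw [_ /vlineP[d ->] ->]].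
rewrite orthprojD (orthproj_orthv_eq0 bw) add0r orthprojZ zetaP.
rewrite dotDr (dotC _ b) (dot_w bw (zeta_orthv _ _)) add0r dotZr -/Z2 mulfK//.
by rewrite subrr scaler0.
Qed.

(** As chi = kappa + tau, the P V terms cancel and a multiple of zeta equals a multiple of F. These
    are orthogonal and nonzero, F because of cos phi, so <zeta, V> and y both vanish. *)
Lemma eigen_eq_chi V y : eigen_eq chi V y <->
  y = 0 /\ V \in (orthv w :&: orthv <[zeta p]> :&: orthv <[F]>)%VS.
Proof.
split.
  move=> /[dup] [[h1 h2]] /eigen_eq_proj [].
  rewrite -/tau chiE opprD addrCA subrr addr0 scalerBr addrAC -scalerDl subrr.
  rewrite scale0r sub0r => h3 h4.
  have hz : dot (zeta p) V = 0.
    have /eqP := congr1 (dot (zeta p)) h3.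
    rewrite !dotE zF mulr0 -/Z2 divfK// oppr_eq0 mulf_eq0 (negbTE kappa_neq0).
    by move/eqP.
  have y0 : y = 0.
    move/esym/eqP: h3; rewrite hz mul0r scale0r scaler0 oppr0.
    rewrite scaler_eq0 (negbTE F_neq0) orbF mulf_eq0.
    by rewrite (negbTE c1_neq0) /= => /eqP.
  split => //; move: h4 h2; rewrite y0 !mulr0 scale0r addr0 => /eqP.
  rewrite scaler_eq0 oppr_eq0 (negbTE kappa_neq0) /= subr_eq0 => /eqP hV /eqP.
  have VP : V \in orthv w by rewrite hV memv_orthproj.
  rewrite oppr_eq0 mulf_eq0 (negbTE k2_neq0) /= JzE dotDr.
  rewrite (dotC V Q) (dot_w Q_in VP) addr0.
  by rewrite !memv_cap VP !memv_orth_line (dotC V (zeta p)) hz eqxx.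
move=> [-> /memv_capP[/memv_capP[VP hz0] hF0]].
have hz : dot V (zeta p) = 0 by apply/eqP; rewrite -memv_orth_line.
have hF : dot V F = 0 by apply/eqP; rewrite -memv_orth_line.
split; last by rewrite JzE dotDr hF (dotC V) (dot_w Q_in VP); ring.
rewrite dotC hz mul0r scale0r subr0 orthproj_id// mulr0 scale0r -scalerDl.
rewrite -/tau chiE.
by rewrite addrA subrr scale0r.
Qed.

Lemma tangent_of_linear a V y V' y' :
  tangent_of (a *: V + V') (a * y + y') =
    a *: tangent_of V y + tangent_of V' y' :> pt.
Proof.
by apply: AN_ext; rewrite !partE ?dotE//; ring.
Qed.

Lemma tangent_of00 : tangent_of 0 0 = 0.
Proof. by apply: AN_ext; rewrite !partE ?dot0r//; ring. Qed.

Let tangent_of0 V : pt := tangent_of V 0.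
Fact tangent_of0_is_linear : linear tangent_of0.
Proof.
by move=> a V V'; rewrite /tangent_of0 -tangent_of_linear mulr0 addr0.
Qed.
HB.instance Definition _ :=
  GRing.isLinear.Build R 'rV[R]_D pt _ tangent_of0 tangent_of0_is_linear.

Lemma has_dim_tangent_of (A : set pt) (V0 : {vspace 'rV[R]_D}) :
  (forall X, A X <-> X = tangent_of (alpha_part X) (theta p X)
     /\ theta p X = 0 /\ alpha_part X \in V0) ->
  has_dim A (\dim V0).
Proof.
move=> hA; exists (linfun tangent_of0 @: V0)%VS; split.
  move=> X; rewrite hA; split.
    move=> [hX [hy hV]]; apply/memv_imgP; exists (alpha_part X) => //.
    by rewrite lfunE /= {1}hX hy.
  move/memv_imgP => [V hV ->]; rewrite lfunE /= /tangent_of0.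
  by rewrite theta_tangent_of alpha_part_mk.
apply: limg_dim_eq; apply/eqP; rewrite -subv0; apply/subvP => V.
rewrite memv_cap memv_ker lfunE /= memv0 => /andP[_ /eqP h].
by have := congr1 (@alpha_part R n) h; rewrite alpha_part_mk alpha_part0 => ->.
Qed.

Lemma has_dim_curvature_tanh :
  has_dim (curvature_space g M eta p (tanh (r / 2) / 2)) (\dim w).
Proof.
(* The line of zeta raises the dimension of [w] by one, and orthogonality to Q lowers it again. *)
have -> : \dim w = \dim ((w + <[zeta p]>) :&: orthv <[Q]>)%VS.
  rewrite dimv_cap_line//; last first.
    by apply: (subvP (addvSl _ _)).
  rewrite dimv_disjoint_sum ?dim_vline ?(zeta_neq0 r_gt0 Mp) ?addn1//.
  apply/eqP; rewrite -subv0; apply/subvP => x; rewrite memv_cap memv0.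
  move=> /andP[xw /vlineP[d e]]; apply/eqP/dot_eq0/(dot_w xw).
  by rewrite e rpredZ// zeta_orthv.
apply: has_dim_tangent_of => X; rewrite curvature_spaceE.
by rewrite tanh_tau eigen_eq_tau.
Qed.

Lemma has_dim_curvature_coth :
  has_dim (curvature_space g M eta p (coth (r / 2) / 2)) (\dim (orthv w) - 2).
Proof.
have -> : (\dim (orthv w) - 2)%N =
    \dim (orthv w :&: orthv <[zeta p]> :&: orthv <[F]>)%VS.
  rewrite dimv_cap_line// ?memv_cap ?F_in ?memv_orth_line 1?dotC ?zF ?eqxx//.
  rewrite dimv_cap_line ?zeta_orthv ?(zeta_neq0 r_gt0 Mp)//.
  by rewrite subn2.
apply: has_dim_tangent_of => X; rewrite curvature_spaceE.
by rewrite coth_chi eigen_eq_chi.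
Qed.

Lemma has_dim_curvature_root l : l != tanh (r / 2) / 2 -> l != coth (r / 2) / 2 ->
  char_cubic l = 0 -> has_dim (curvature_space g M eta p l) 1.
Proof.
rewrite tanh_tau coth_chi => h1 h2 hq.
pose X0 := tangent_of (Vl l) 1; exists <[X0]>%VS; split; last first.
  rewrite dim_vline; suff -> : X0 != 0 by [].
  apply/eqP => e; have := theta_tangent_of (Vl l) 1; rewrite -/X0 e.
  rewrite -(scale0r 0) thetaZr mul0r => /esym/eqP; apply/negP; exact: oner_neq0.
have hX0 y : y *: X0 = tangent_of (y *: Vl l) y.
  have := tangent_of_linear y (Vl l) 1 0 0.
  by rewrite tangent_of00 !addr0 mulr1.
move=> X; rewrite curvature_spaceE eigen_eq_generic//; split.
  by move=> [hX [hV _]]; rewrite hX hV -hX0 rpredZ// memv_line.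
move/vlineP => [y ->]; rewrite hX0 theta_tangent_of alpha_part_mk.
by rewrite hq mulr0.
Qed.

Lemma principal_curvature_root l : principal_curvature g M eta p l ->
  [\/ l = tanh (r / 2) / 2, l = coth (r / 2) / 2 | char_cubic l = 0].
Proof.
rewrite tanh_tau coth_chi.
move=> [X X0 /curvature_spaceE[hX]].
have [->|h1] := eqVneq l tau; first by move=> _; apply: Or31.
have [->|h2] := eqVneq l chi; first by move=> _; apply: Or32.
rewrite eigen_eq_generic// => -[hV /eqP]; rewrite mulf_eq0 => /orP[/eqP hy|/eqP].
  by move: X0; rewrite hX hV hy scale0r tangent_of00 eqxx.
by move=> h; apply: Or33.
Qed.

Lemma has_dim_tangent : (0 < n)%N -> has_dim (tangent M p) (2 * n - 1).
Proof.
(* Half the Euclidean gradient of |zeta|^2 - 4 sinh^2 (r/2) e^a at p, so the tangent space is its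
   complement for [dot]. *)
move=> n0; pose N0 : pt := mkAN (- (Z2 / 2)) (zeta p) 0.
exists (orthv <[N0]>); split.
  move=> X; rewrite (tangent_tube r_gt0 _ Mp) memv_orth_line dot_parts !partsE.
  have e : 2 * sinh (r / 2) ^+ 2 * expR (a_part p) = Z2 / 2.
    by rewrite /Z2 Mp; field.
  rewrite e (dotC (alpha_part X)); split => [->|/eqP]; last by lra.
  by apply/eqP; ring.
have N00 : N0 != 0.
  apply/eqP => /(congr1 (@alpha_part R n)); rewrite alpha_part_mk alpha_part0.
  exact/eqP/(zeta_neq0 r_gt0 Mp).
have := dimv_orthv <[N0]>; rewrite dim_vline N00; exact: (dim_hyperplane_AN n0).
Qed.

End PrincipalCurvatures.

(** * The cubic equation *)

Section CubicRoots.
Variable R : realType.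
Local Open Scope complex_scope.

(** The divided difference at two distinct roots y, z gives y^2 + y z + z^2 = 3. Comparing two such
    relations, [v j0], [v j1] and any further root sum to 0, so that further root is [v j2]. *)
Lemma three_distinct_roots (b : R) (v : 'I_3 -> R) : injective v ->
  (forall j, v j ^+ 3 - 3 * v j = b) ->
  forall x, x ^+ 3 - 3 * x = b -> exists j, x = v j.
Proof.
move=> vinj hv x hx.
pose j0 : 'I_3 := @Ordinal 3 0 isT; pose j1 : 'I_3 := @Ordinal 3 1 isT.
pose j2 : 'I_3 := @Ordinal 3 2 isT.
have quad (y z : R) : y ^+ 3 - 3 * y = b -> z ^+ 3 - 3 * z = b -> y != z ->
    y ^+ 2 + y * z + z ^+ 2 = 3.
  move=> hy hz yz; apply: (mulfI (_ : y - z != 0)); first by rewrite subr_eq0.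
  have -> : (y - z) * (y ^+ 2 + y * z + z ^+ 2) =
      (y ^+ 3 - 3 * y) - (z ^+ 3 - 3 * z) + (y - z) * 3 by ring.
  by rewrite hy hz subrr add0r.
have d01 : v j0 != v j1 by apply/eqP => /vinj.
have d02 : v j0 != v j2 by apply/eqP => /vinj.
have d12 : v j1 != v j2 by apply/eqP => /vinj.
have [->|x0] := eqVneq x (v j0); first by exists j0.
have [->|x1] := eqVneq x (v j1); first by exists j1.
exists j2.
have q01 := quad _ _ (hv j0) (hv j1) d01.
have q02 := quad _ _ (hv j0) (hv j2) d02.
have qx := quad _ _ hx (hv j0) x0.
have sum0 : v j0 + v j1 + v j2 = 0.
  apply: (mulfI (_ : v j1 - v j2 != 0)); first by rewrite subr_eq0.
  have -> : (v j1 - v j2) * (v j0 + v j1 + v j2) =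
      (v j0 ^+ 2 + v j0 * v j1 + v j1 ^+ 2)
      - (v j0 ^+ 2 + v j0 * v j2 + v j2 ^+ 2) by ring.
  by rewrite q01 q02 subrr mulr0.
have sumx : x + v j0 + v j1 = 0.
  apply: (mulfI (_ : x - v j1 != 0)); first by rewrite subr_eq0.
  have -> : (x - v j1) * (x + v j0 + v j1) =
      (x ^+ 2 + x * v j0 + v j0 ^+ 2)
      - (v j0 ^+ 2 + v j0 * v j1 + v j1 ^+ 2) by ring.
  by rewrite qx q01 subrr mulr0.
lra.
Qed.

(** As |b| < 2, [sq] is purely imaginary, so u^3 and hence u have modulus 1. Then 1/u is the
    conjugate, v = 2 Re u is real, and v^3 - 3 v = u^3 + u^(-3) = b. *)
Lemma cube_root_trace (b : R) (sq : R[i]) (u : 'I_3 -> R[i]) :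
  -2 < b < 2 -> sq ^+ 2 = (b ^+ 2 - 4)%:C -> injective u ->
  (forall j, u j ^+ 3 = (b%:C + sq) / 2) ->
  exists v : 'I_3 -> R, [/\ forall j, (v j)%:C = u j + (u j)^-1,
    forall j, v j ^+ 3 - 3 * v j = b & injective v].
Proof.
move=> /andP[b1 b2] hsq uinj hu.
case: sq hsq hu => x y hsq hu; move: hsq; rewrite expr2; simpc => -[hx hy].
(* A nonzero real part would make [sq] real, against sq^2 = b^2 - 4 < 0. *)
have x0 : x = 0.
  apply/eqP/negP => /negP x0; have : y = 0.
    by apply: (mulfI x0); rewrite mulr0; lra.
  by move=> y0; move: hx; rewrite y0; nra.
rewrite {}x0 in hx hy hu.
have hre j : let a := complex.Re (u j) in let c := complex.Im (u j) in
    [/\ u j = a +i* c, 2 * (a ^+ 3 - 3 * a * c ^+ 2) = b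
      & 2 * (3 * a ^+ 2 * c - c ^+ 3) = y].
  have := hu j; case: (u j) => a c /= h.
  have : (a +i* c) ^+ 3 * 2 = b%:C + (0 +i* y).
    by rewrite h divfK// pnatr_eq0.
  rewrite !exprS expr0 mulr1 mulr_natr mulr2n; simpc => -[e1 e2].
  by split => //; [rewrite -e1 | rewrite -e2]; ring.
have hN j : complex.Re (u j) ^+ 2 + complex.Im (u j) ^+ 2 = 1.
  have [] := hre j; set a := complex.Re _; set c := complex.Im _ => _ e1 e2.
  have : (a ^+ 2 + c ^+ 2) ^+ 3 = 1.
    have -> : (a ^+ 2 + c ^+ 2) ^+ 3 = ((2 * (a ^+ 3 - 3 * a * c ^+ 2)) ^+ 2
       + (2 * (3 * a ^+ 2 * c - c ^+ 3)) ^+ 2) / 4 by field.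
    rewrite e1 e2; have -> : y ^+ 2 = 4 - b ^+ 2 by rewrite expr2; lra.
    by field.
  have h0 : 0 <= a ^+ 2 + c ^+ 2 by rewrite addr_ge0// sqr_ge0.
  by move/eqP; rewrite pexpr_eq1// => /eqP.
exists (fun j => 2 * complex.Re (u j)); split => j.
- have [e _ _] := hre j; have := hN j.
  set a := complex.Re _ in e *; set c := complex.Im _ in e * => N1.
  have ui : (u j)^-1 = a -i* c.
    apply: (mulfI (_ : u j != 0)).
      apply/eqP => u0; move: N1; rewrite /a /c u0 /= expr0n/= addr0 => /eqP.
      by rewrite eq_sym oner_eq0.
    rewrite mulfV; last first.
      apply/eqP => u0; move: N1; rewrite /a /c u0 /= expr0n/= addr0 => /eqP.
      by rewrite eq_sym oner_eq0.
    rewrite e; simpc; apply/eqP; rewrite eq_complex /=.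
    apply/andP; split; apply/eqP; first by rewrite -N1; ring.
    by ring.
  rewrite ui e; simpc; congr (_ +i* _).
  by ring.
- have [_ e1 _] := hre j; have := hN j.
  set a := complex.Re _ in e1 *; set c := complex.Im _ in e1 * => N1.
  have : c ^+ 2 = 1 - a ^+ 2 by rewrite -N1; ring.
  by move=> c2; rewrite -e1 c2; ring.
- move=> j' e; apply: uinj.
  have [eu _ e2] := hre j; have [eu' _ e2'] := hre j'.
  have ea : complex.Re (u j) = complex.Re (u j').
    by apply: (mulfI (_ : (2 : R) != 0)); rewrite ?pnatr_eq0.
  suff ec : complex.Im (u j) = complex.Im (u j') by rewrite eu eu' ea ec.
  have N1 := hN j; have N2 := hN j'; rewrite -ea in N2 e2'.
  clear eu eu'.
  set a := complex.Re _ in e2 e2' N1 N2; set c := complex.Im _ in e2 N1 *.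
  set c' := complex.Im _ in e2' N2 *.
  (* Unit numbers with equal real parts are equal or conjugate, and conjugates have conjugate cubes.
     In coordinates, y / 2 = Im u^3 = c (4 a^2 - 1), which is nonzero and determines c from a. *)
  have y0 : y != 0 by apply/eqP => y0; move: hx; rewrite y0; nra.
  have f1 : c * (2 * (4 * a ^+ 2 - 1)) = y.
    have c2 : c ^+ 2 = 1 - a ^+ 2 by rewrite -N1 addrC addKr.
    by rewrite -e2 (exprSr c 2) c2; ring.
  have f2 : c' * (2 * (4 * a ^+ 2 - 1)) = y.
    have c2 : c' ^+ 2 = 1 - a ^+ 2 by rewrite -N2 addrC addKr.
    by rewrite -e2' (exprSr c' 2) c2; ring.
  apply: (mulIf (_ : 2 * (4 * a ^+ 2 - 1) != 0)).
    by apply/eqP => e0; move: y0; rewrite -f1 e0 mulr0 eqxx.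
  by rewrite f1 f2.
Qed.

End CubicRoots.

(** * The affine substitution and the range of beta *)

Section Lambda.
Variables (R : realType) (r phi : R).
Hypothesis r_gt0 : 0 < r.
Hypothesis hphi : 0 < phi < pi / 2.
Let rho := r / 2.
Let beta : R := 27 * sin phi ^+ 2 * tanh rho ^+ 2 * sech rho ^+ 4 - 2.
Let T := tanh rho.
Let S := sin phi ^+ 2.

Let rho_gt0 : 0 < rho. Proof. by rewrite divr_gt0. Qed.

Lemma sin_acute_neq0 : sin phi != 0.
Proof.
case/andP: hphi => h1 h2; rewrite lt0r_neq0// sin_gt0_pi// h1/=.
by rewrite (lt_trans h2)// ltr_pdivrMr// ltr_pMr ?pi_gt0// ltr1n.
Qed.

Lemma cos_acute_neq0 : cos phi != 0.
Proof.
case/andP: hphi => h1 h2; rewrite lt0r_neq0// cos_gt0_pihalf// h2 andbT.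
by rewrite (lt_trans _ h1)// oppr_lt0 divr_gt0// pi_gt0.
Qed.

Lemma tanh_half_gt0 : 0 < T.
Proof. by rewrite /T /tanh divr_gt0 ?cosh_gt0// sinh_gt0. Qed.

Lemma coth_halfE : coth rho = T^-1.
Proof. by rewrite /T /tanh invf_div. Qed.

Lemma sech_half_sqr : sech rho ^+ 2 = 1 - T ^+ 2.
Proof.
rewrite /sech /T /tanh -[X in X - _](mulfV (expf_neq0 2 (cosh_neq0 rho))).
rewrite -[X in X / _ - _](subrK (sinh rho ^+ 2)) cosh2B_sinh2.
by field; rewrite cosh_neq0.
Qed.

Lemma csch_sech_half : csch rho * sech rho = T^-1 - T.
Proof.
have s0 : sinh rho != 0 by rewrite lt0r_neq0// sinh_gt0.
have c0 := cosh_neq0 rho.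
rewrite /csch /sech /T /tanh.
have -> : (sinh rho / cosh rho)^-1 - sinh rho / cosh rho =
  (cosh rho ^+ 2 - sinh rho ^+ 2) / (sinh rho * cosh rho).
  by field; rewrite s0 c0.
by rewrite cosh2B_sinh2; field; rewrite s0 c0.
Qed.

Lemma betaE : beta = 27 * S * T ^+ 2 * (1 - T ^+ 2) ^+ 2 - 2.
Proof. by rewrite /beta (exprM _ 2 2) sech_half_sqr. Qed.

(** With x = tanh^2 (r/2), the maximum of x (1 - x)^2 on 0 < x < 1 is 4/27, at x = 1/3; the factor
    27 turns it into 4. The lower bound is strict because sin phi is nonzero, the upper one because
    cos phi is. *)
Lemma beta_bounds : -2 < beta < 2.
Proof.
rewrite betaE.
have S0 : 0 < S by rewrite exprn_even_gt0//= sin_acute_neq0.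
have C0 : 0 < cos phi ^+ 2 by rewrite exprn_even_gt0//= cos_acute_neq0.
have S1 : S < 1 by have := cos2Dsin2 phi; rewrite -/S; lra.
have t0 : 0 < T ^+ 2 by rewrite exprn_gt0// tanh_half_gt0.
have t1 : 0 < 1 - T ^+ 2.
  by rewrite -sech_half_sqr exprn_gt0// /sech invr_gt0 cosh_gt0.
set x := T ^+ 2 in t0 t1 *.
have g0 : 0 < x * (1 - x) ^+ 2 by rewrite mulr_gt0// exprn_gt0.
have g1 : 27 * (x * (1 - x) ^+ 2) <= 4.
  rewrite -subr_ge0.
  have -> : 4 - 27 * (x * (1 - x) ^+ 2) = 27 * ((x - 3^-1) ^+ 2 * (4 / 3 - x)).
    by field.
  by rewrite mulr_ge0// mulr_ge0 ?sqr_ge0//; lra.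
set y := x * (1 - x) ^+ 2 in g0 g1.
have -> : 27 * S * x * (1 - x) ^+ 2 = S * (27 * y) by rewrite /y; ring.
apply/andP; split; first by rewrite -subr_gt0 opprK addrNK mulr_gt0// mulr_gt0.
rewrite ltrBlDr; apply: (@lt_le_trans _ _ (27 * y)); last by lra.
by rewrite -subr_gt0 -[X in X - _]mul1r -mulrBl mulr_gt0//; lra.
Qed.

(** The signs can be checked on the trace: the three v sum to 0, so the three values sum to (csch
    sech + 4 tanh) / 2 = (coth + 3 tanh) / 2, which is the sum of tanh, coth / 2 and tanh / 2
    prescribed by the cubic. *)
Definition lambda (v : R) : R :=
  - 6^-1 * (coth rho * v - csch rho * sech rho - 4 * tanh rho).

Lemma lambdaE v : lambda v = T / 2 + T^-1 * (1 - v) / 6.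
Proof.
rewrite /lambda coth_halfE csch_sech_half -/T; field.
by rewrite lt0r_neq0// tanh_half_gt0.
Qed.

Lemma char_cubicE l : char_cubic r phi l =
  (T - l) * (2^-1 * T^-1 - l) * (2^-1 * T - l)
  - (1 - T ^+ 2) / 4 * ((1 - S) * (2^-1 * T - l) + S * (2^-1 * T^-1 - l)).
Proof.
rewrite /char_cubic -/rho -/T -/S -[cosh rho / sinh rho]/(coth rho) coth_halfE.
have -> : cos phi ^+ 2 = 1 - S by rewrite /S -(cos2Dsin2 phi) addrK.
by rewrite -sech_half_sqr /sech; congr (_ - _ * _); field; rewrite cosh_neq0.
Qed.

(** The substitution puts the mean of the roots at v = 0, which removes the quadratic term; its
    scale 1 / (6 T) makes the linear coefficient -3, and the cube of that scale is the factor in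
    front. *)
Lemma char_cubic_lambda v :
  char_cubic r phi (lambda v) = T^-1 ^+ 3 / 216 * (v ^+ 3 - 3 * v - beta).
Proof.
rewrite char_cubicE lambdaE betaE; field.
by rewrite lt0r_neq0// tanh_half_gt0.
Qed.

Lemma char_cubic_lambda_eq0 v :
  char_cubic r phi (lambda v) = 0 <-> v ^+ 3 - 3 * v = beta.
Proof.
have T0 : T != 0 by rewrite lt0r_neq0// tanh_half_gt0.
rewrite char_cubic_lambda; split => [/eqP|->]; last by rewrite subrr mulr0.
rewrite mulf_eq0 mulf_eq0 expf_eq0 !invr_eq0 (negbTE T0) pnatr_eq0/= subr_eq0.
by move/eqP.
Qed.

Lemma lambda_inj : injective lambda.
Proof.
have T0 : T^-1 != 0 by rewrite invr_eq0 lt0r_neq0// tanh_half_gt0.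
move=> v v'; rewrite !lambdaE => h; apply: (mulfI T0); lra.
Qed.

Lemma lambda_surj l : exists v, l = lambda v.
Proof.
have T0 : T != 0 by rewrite lt0r_neq0// tanh_half_gt0.
by exists (1 - 6 * T * (l - T / 2)); rewrite lambdaE; field.
Qed.

Let weight_neq0 : (1 - T ^+ 2) / 4 * (T^-1 - T) != 0.
Proof.
rewrite -sech_half_sqr -csch_sech_half mulf_neq0//.
  by rewrite mulf_neq0 ?invr_eq0 ?pnatr_eq0// expf_neq0// invr_eq0 cosh_neq0.
by rewrite mulf_neq0// invr_eq0 ?cosh_neq0// lt0r_neq0// sinh_gt0.
Qed.

(** At this value only the sin^2 term of the cubic survives; at coth / 2 it is the cos^2 term. *)
Lemma char_cubic_tanh_neq0 : char_cubic r phi (tanh rho / 2) != 0.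
Proof.
have T0 : T != 0 by rewrite lt0r_neq0// tanh_half_gt0.
rewrite char_cubicE -/T.
have -> : (T - T / 2) * (2^-1 * T^-1 - T / 2) * (2^-1 * T - T / 2) -
  (1 - T ^+ 2) / 4 * ((1 - S) * (2^-1 * T - T / 2) + S * (2^-1 * T^-1 - T / 2)) =
  - (S / 2) * ((1 - T ^+ 2) / 4 * (T^-1 - T)) by field.
rewrite mulf_neq0// oppr_eq0 mulf_neq0 ?invr_eq0 ?pnatr_eq0//.
by rewrite expf_neq0// sin_acute_neq0.
Qed.

Lemma char_cubic_coth_neq0 : char_cubic r phi (coth rho / 2) != 0.
Proof.
have T0 : T != 0 by rewrite lt0r_neq0// tanh_half_gt0.
rewrite char_cubicE coth_halfE.
have -> : (T - T^-1 / 2) * (2^-1 * T^-1 - T^-1 / 2) * (2^-1 * T - T^-1 / 2) -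
  (1 - T ^+ 2) / 4 * ((1 - S) * (2^-1 * T - T^-1 / 2)
    + S * (2^-1 * T^-1 - T^-1 / 2)) =
  (1 - S) / 2 * ((1 - T ^+ 2) / 4 * (T^-1 - T)) by field.
rewrite mulf_neq0// mulf_neq0 ?invr_eq0 ?pnatr_eq0//.
by rewrite /S -(cos2Dsin2 phi) addrK expf_neq0// cos_acute_neq0.
Qed.

End Lambda.

(** * The Kähler angle as the norm of a projection *)

Section KahlerAngle.
Variables (R : realType) (n : nat) (phi : R).
Variable w : {vspace 'rV[R]_(n.-1 + n.-1)}.
Hypothesis hw_angle : constant_kahler_angle phi (orth_compl w).
Local Notation P := (orthproj (orthv w)).

Lemma orth_complE : orth_compl w = [set x | x \in orthv w].
Proof. by apply/seteqP; split=> x /memv_orthv. Qed.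

(** Orthogonal projections are unique, so the vector supplied by the angle hypothesis is
    [P (Jmx x)]; the squared form also covers x = 0. *)
Lemma kahler_orthproj x : x \in orthv w ->
  dot (P (Jmx x)) (P (Jmx x)) = cos phi ^+ 2 * dot x x.
Proof.
move=> xw; have [->|x0] := eqVneq x 0.
  by rewrite Jmx0 !dot0l dot_orthprojC dot0l mulr0.
have [|y [yw hy] ny] := hw_angle _ x0; first by rewrite orth_complE.
have -> : P (Jmx x) = y.
  move: yw hy; rewrite orth_complE /= => yw hy.
  have PJ : P (Jmx x - y) = 0.
    by apply/eqP; rewrite orthproj_eq0; apply/memv_orthv => z; exact: hy.
  by move: PJ; rewrite -scaleN1r orthprojD orthprojZ (orthproj_id yw) scaleN1r
    => /subr0_eq.
by rewrite -!sqr_enorm ny exprMn.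
Qed.

End KahlerAngle.

Lemma principal_curvature_of_dim (R : realType) (N : nat) (g : metric R N)
    (M : set 'rV[R]_N) (eta : 'rV[R]_N -> 'rV[R]_N) (p : 'rV[R]_N) (l : R) d :
  has_dim (curvature_space g M eta p l) d ->
  principal_curvature g M eta p l <-> (0 < d)%N.
Proof.
move=> [V [hV <-]]; rewrite lt0n dimv_eq0; split.
  move=> [X X0 /hV XV]; apply: contraNneq X0 => V0.
  by move: XV; rewrite V0 memv0.
by move=> V0; exists (vpick V); [rewrite vpick0 | apply/hV; exact: memv_pick].
Qed.

Theorem mainTheorem3 (R : realType) (n k : nat) (phi r : R)
    (w : {vspace 'rV[R]_(n.-1 + n.-1)}) (sq : R[i]) (u : 'I_3 -> R[i])
    (hn : (3 <= n)%N) (hphi : 0 < phi < pi / 2)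
    (hk : (2 <= k <= n.-1)%N) (hk_even : ~~ odd k) (hr : 0 < r)
    (hw_dim : has_dim (orth_compl w) k)
    (hw_angle : constant_kahler_angle phi (orth_compl w)) :
  let rho := r / 2 in
  let beta : R := 27 * sin phi ^+ 2 * tanh rho ^+ 2 * sech rho ^+ 4 - 2 in
  forall (hsq : sq ^+ 2 = (beta ^+ 2 - 4)%:C%C)
    (hu_inj : injective u)
    (hu : forall j, u j ^+ 3 = (beta%:C%C + sq) / 2),
  let g := @gAN R n in
  let M := tube g (Wphi w) r in
  exists (lam : 'I_3 -> R) (eta : AN R n -> AN R n),
  [/\ forall j, (lam j)%:C%C =
        - 6^-1 * ((coth rho)%:C%C * (u j + (u j)^-1)
                  - (csch rho * sech rho)%:C%C - (4 * tanh rho)%:C%C),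
      M !=set0 /\
        unit_normal_field g M eta /\ points_towards g (Wphi w) r eta,
      forall p, M p ->
        [/\ has_dim (tangent M p) (2 * n - 1),
            forall j, has_dim (curvature_space g M eta p (lam j)) 1,
            has_dim (curvature_space g M eta p (tanh rho / 2)) (2 * n - k - 2),
            has_dim (curvature_space g M eta p (coth rho / 2)) (k - 2)
          & forall x, principal_curvature g M eta p x ->
              [\/ exists j, x = lam j, x = tanh rho / 2 | x = coth rho / 2]],
      injective lam /\
        forall j, lam j <> tanh rho / 2 /\ lam j <> coth rho / 2
    & exists cs : seq R,
        [/\ uniq cs, size cs = (if (2 < k)%N then 5%N else 4%N)
          & forall p, M p ->
              forall x, principal_curvature g M eta p x <-> x \in cs]].
Proof.
move=> rho beta hsq u_inj u_cube g M.
have sphi := sin_acute_neq0 hphi; have cphi := cos_acute_neq0 hphi.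
have [v [hv v_root v_inj]] :=
  cube_root_trace (beta_bounds hr hphi) hsq u_inj u_cube.
have dim_orth : \dim (orthv w) = k.
  have [V [hV <-]] := hw_dim; congr (\dim _); apply/vspaceP => x.
  by apply/memv_orthv/idP => /hV.
have dim_w : \dim w = (2 * n - k - 2)%N.
  move: (dimv_orthv w); rewrite dim_orth; move: hn hk; clear.
  by move=> hn hk; lia.
have EM : M = tube_level w r by rewrite /M WphiE; exact: tubeE.
pose lam j := lambda r (v j).
have lam_inj : injective lam by move=> i j /(lambda_inj hr)/v_inj.
have lam_root j : char_cubic r phi (lam j) = 0.
  by apply/char_cubic_lambda_eq0.
have lam_tanh j : lam j != tanh rho / 2.
  by apply: contraNneq (char_cubic_tanh_neq0 hr hphi) => <-; rewrite lam_root.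
have lam_coth j : lam j != coth rho / 2.
  by apply: contraNneq (char_cubic_coth_neq0 hr hphi) => <-; rewrite lam_root.
have curv p : M p ->
    [/\ has_dim (tangent M p) (2 * n - 1),
      forall j, has_dim (curvature_space g M (eta w r) p (lam j)) 1,
      has_dim (curvature_space g M (eta w r) p (tanh rho / 2)) (2 * n - k - 2),
      has_dim (curvature_space g M (eta w r) p (coth rho / 2)) (k - 2)
    & forall x, principal_curvature g M (eta w r) p x ->
      [\/ exists j, x = lam j, x = tanh rho / 2 | x = coth rho / 2]].
  rewrite EM => Mp.
  pose F := orthproj (orthv w) (Jmx (zeta w p)).
  have F_in : F \in orthv w by exact: memv_orthproj.
  have Q_in : Jmx (zeta w p) - F \in w.
    by have := sub_orthproj (orthv w) (Jmx (zeta w p)); rewrite orthvK.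
  have JzE : Jmx (zeta w p) = F + (Jmx (zeta w p) - F) by rewrite addrC subrK.
  have FF := kahler_orthproj hw_angle (zeta_orthv w p).
  split.
  - by apply: (has_dim_tangent hr Mp); move: hn; clear; lia.
  - move=> j; apply: (has_dim_curvature_root hr Mp F_in Q_in JzE FF) => //.
  - by rewrite -dim_w; exact: (has_dim_curvature_tanh hr sphi Mp F_in Q_in JzE FF).
  - rewrite -dim_orth.
    exact: (has_dim_curvature_coth hr cphi Mp F_in Q_in JzE FF).
  - move=> x /(principal_curvature_root hr Mp F_in Q_in JzE FF) [->|->|hx].
    + exact: Or32.
    + exact: Or33.
    (* Every real is of the form [lambda r y], so a root of the characteristic cubic yields a root y
       of y^3 - 3 y = beta, which is one of the three [v j]. *)
    + apply: Or31; have [y hy] := lambda_surj hr x; move: hx; rewrite hy.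
      move=> /(char_cubic_lambda_eq0 _ hr).
      move=> /(three_distinct_roots v_inj v_root) [j ->].
      by exists j.
(* Twice their difference is csch sech, which is nonzero. *)
have tanh_coth : tanh rho / 2 != coth rho / 2.
  apply/eqP => e; have := csch_sech_half hr; rewrite -(coth_halfE r).
  have -> : coth (r / 2) - tanh (r / 2) = 0 by move: e; rewrite /rho; lra.
  apply/eqP; rewrite mulf_neq0// invr_eq0 ?cosh_neq0//.
  by rewrite lt0r_neq0// sinh_gt0// divr_gt0.
exists lam, (eta w r); split => //.
- move=> j; rewrite -hv /lam /lambda.
  by rewrite !(rmorphM, rmorphB, rmorphN, fmorphV, rmorph_nat).
- split; last first.
    rewrite EM WphiE; split; first exact: eta_unit_normal_field.
    exact: eta_points_towards.
  (* A point of the tube: any nonzero x normal to [w], with a read off from the level equation. *)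
  pose x := vpick (orthv w).
  have x0 : x != 0.
    by rewrite vpick0 -dimv_eq0 dim_orth; move: hk; clear; case: k.
  have s0 : 0 < sinh (r / 2) by rewrite sinh_gt0// divr_gt0.
  rewrite EM; exists (mkAN (ln (dot x x / (4 * sinh (r / 2) ^+ 2))) x 0).
  rewrite /tube_level /= /zeta !partsE orthproj_id ?memv_pick// lnK.
    by rewrite mulrC divfK// mulf_neq0 ?expf_neq0 ?pnatr_eq0// lt0r_neq0.
  by rewrite posrE divr_gt0 ?dot_gt0// mulr_gt0// exprn_gt0.
- by split=> // j; split; apply/eqP.
(* For k = 2 the value coth / 2 has multiplicity 0 and is left out of the list. *)
- exists (map lam (enum 'I_3) ++ (tanh rho / 2) ::
    (if (2 < k)%N then [:: coth rho / 2] else [::])); split.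
  + rewrite cat_uniq map_inj_uniq// enum_uniq /=.
    have h1 : tanh rho / 2 \notin map lam (enum 'I_3).
      by apply/mapP => -[j _ e]; move: (lam_tanh j); rewrite -e eqxx.
    have h2 : coth rho / 2 \notin map lam (enum 'I_3).
      by apply/mapP => -[j _ e]; move: (lam_coth j); rewrite -e eqxx.
    case: ifP => _ /=; rewrite (negbTE h1) ?(negbTE h2) ?orbF //=.
    by rewrite inE (negbTE tanh_coth).
  + by rewrite size_cat size_map size_enum_ord; case: ifP.
  + move=> p Mp x; have [_ hlam htanh hcoth hall] := curv p Mp.
    rewrite mem_cat inE; split.
      move=> hx; case: (hall x hx) => [[j e]|e|e].
      * by apply/orP; left; rewrite e map_f// mem_enum.
      * by rewrite e eqxx orbT.
      (* An eigenvector for coth / 2 makes its multiplicity k - 2 positive, which selects the longer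
         list. *)
      * have : (0 < k - 2)%N.
          by apply/(principal_curvature_of_dim hcoth); rewrite -e.
        by rewrite subn_gt0 => ->; rewrite e inE eqxx !orbT.
    case/or3P => [/mapP[j _ ->]|/eqP ->|].
    * exact/(principal_curvature_of_dim (hlam j)).
    * by apply/(principal_curvature_of_dim htanh); move: hn hk; clear; lia.
    * case: ifP => // k2; rewrite inE => /eqP ->.
      by apply/(principal_curvature_of_dim hcoth); rewrite subn_gt0.
Qed.
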